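(* Let $M$ be a matroid on $[n]$, $\mathcal{C}_L$ a linear class of circuits of $M$, and $\mathbf{K}$ a field. Let $\mathcal{E}=\bigwedge\bigl(\bigoplus_{i=1}^n\mathbf{K}e_i\bigr)$ and $\Im(\mathcal{C}_L)=\{\partial e_C: C\in\mathcal{C}_L,|C|>1\}\cup\{e_C: C\in\mathcal{C}(M)\}$. Put $\mathbf{nbc}_{\mathcal{C}_L}:=\{e_I: I\in\operatorname{NBC}_{\mathcal{C}_L}\}$ and $$\mathbf{b}_{\Im(\mathcal{C}_L)}:=\{\partial e_U: U\text{ is a }\mathcal{C}_L\text{-inactive }\mathcal{C}_L\text{-unidependent set}\}\cup\{e_D: D\subseteq[n]\text{ dependent in }M\}.$$ Then (the image of) $\mathbf{nbc}_{\mathcal{C}_L}$ is a basis of the bias $\mathbf{K}$-algebra $\operatorname{Z}(M,\mathcal{C}_L)$, and $\mathbf{b}_{\Im(\mathcal{C}_L)}$ is a basis of the two-sided ideal $\langle\Im(\mathcal{C}_L)\rangle$ of $\mathcal{E}$.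
   Context: $\mathcal{C}(M)$: circuits of $M$; $\operatorname{cl}$: closure. Linear class: $\mathcal{C}_L\subseteq\mathcal{C}(M)$ such that whenever $C_1,C_2\in\mathcal{C}_L$ satisfy $\operatorname{r}(C_1)+\operatorname{r}(C_2)=\operatorname{r}(C_1\cup C_2)+\operatorname{r}(C_1\cap C_2)$, every circuit contained in $C_1\cup C_2$ is in $\mathcal{C}_L$. Exterior algebra notation: $e_X=e_{i_1}\wedge\dots\wedge e_{i_m}$ for $X=\{i_1<\dots<i_m\}$, $e_\emptyset=1$; $\partial$ linear with $\partial e_\emptyset=0$, $\partial e_X=\sum_{j=1}^m(-1)^j e_{X\setminus i_j}$. Orlik–Solomon algebra $\operatorname{OS}(N)$ of a matroid $N$: exterior algebra on its elements modulo the ideal generated by $\partial e_C$ ($C$ circuit, $|C|>1$) and $e_C$ ($C$ circuit). Extended lift $N$ on $[n+1]$: $N^\star$ is the single-element extension of $M^\star$ with $n+1\in\operatorname{cl}_{N^\star}(H)$ iff $[n]\setminus H\in\mathcal{C}_L$, for each hyperplane $H$ of $M^\star$; $N=(N^\star)^\star$. Bias algebra: $\operatorname{Z}(M,\mathcal{C}_L)=\operatorname{OS}(N)/\langle e_{n+1}\rangle$. For an independent set $I$ and a non-loop $x\in\operatorname{cl}(I)\setminus I$, let $C(x,I)$ be the unique circuit in $I\cup x$; $x$ is $\mathcal{C}_L$-active in $I$ if $C(x,I)\in\mathcal{C}_L$ and $x=\min C(x,I)$. A set $U\subseteq[n]$ is $\mathcal{C}_L$-unidependent if it contains a unique circuit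 $C(U)$ of $M$, with $C(U)\in\mathcal{C}_L$ and $|C(U)|>1$; it is $\mathcal{C}_L$-inactive if $\min C(U)$ is the smallest $\mathcal{C}_L$-active element of the independent set $U\setminus\min C(U)$. For $C\in\mathcal{C}_L$, $|C|>1$, $C\setminus\min C$ is a $\mathcal{C}_L$-broken circuit; $\operatorname{NBC}_{\mathcal{C}_L}$ is the family of independent sets of $M$ containing no $\mathcal{C}_L$-broken circuit. *)

(* Defs.v *)
From HB Require Import structures.
From mathcomp Require Import all_boot all_order all_algebra all_field.
From mathcomp Require Import zify.
Set Implicit Arguments.
Unset Strict Implicit.
Unset Printing Implicit Defensive.

Section MatroidDef.
Variable T : finType.

Definition matroid_axiom (F : {set {set T}}) : bool :=
  [&& set0 \in F,
      [forall J in F, forall I : {set T}, (I \subset J) ==> (I \in F)]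
    & [forall I in F, forall J in F, (#|I| < #|J|) ==>
        [exists x in J :\: I, x |: I \in F]]].

Record matroid := Matroid { indep : {set {set T}}; _ : matroid_axiom indep }.

HB.instance Definition _ := [isSub for indep].
HB.instance Definition _ := [Equality of matroid by <:].
HB.instance Definition _ := [Choice of matroid by <:].

Lemma matroid_axiomP (F : {set {set T}}) :
  reflect [/\ set0 \in F,
              (forall I J : {set T}, J \in F -> I \subset J -> I \in F)
            & (forall I J : {set T}, I \in F -> J \in F -> #|I| < #|J| ->
                exists2 x, x \in J :\: I & x |: I \in F)]
          (matroid_axiom F).
Proof.
apply: (iffP and3P) => -[F0 Fs Fa]; split=> //.
- by move=> I J FJ sIJ; have /forall_inP/(_ J FJ)/forallP/(_ I)/implyP := Fs; apply.
- move=> I J FI FJ lt.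
  have /forall_inP/(_ I FI)/forall_inP/(_ J FJ)/implyP/(_ lt) := Fa.
  by case/exists_inP=> x; exists x.
- by apply/forall_inP=> J FJ; apply/forallP=> I; apply/implyP; apply: Fs.
- apply/forall_inP=> I FI; apply/forall_inP=> J FJ; apply/implyP=> lt.
  by have [x xJ xF] := Fa _ _ FI FJ lt; apply/exists_inP; exists x.
Qed.

Variable M : matroid.
Implicit Types (A B C D E I J X : {set T}) (x y z : T).

Definition circuits : {set {set T}} :=
  [set C | minset [pred A : {set T} | A \notin indep M] C].

Definition bases : {set {set T}} := [set B | maxset [in indep M] B].

Definition mrank (A : {set T}) : nat :=
  \max_(I in indep M | I \subset A) #|I|.

Definition mclosure (A : {set T}) : {set T} :=
  [set x | mrank (x |: A) == mrank A].

Definition hyperplanes : {set {set T}} :=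
  [set H | (mclosure H == H) && ((mrank H).+1 == mrank setT)].

Definition dual_indep : {set {set T}} :=
  [set X : {set T} | [exists B in bases, X \subset ~: B]].

Lemma indep0 : set0 \in indep M.
Proof. by case: M => F /= /matroid_axiomP[]. Qed.

Lemma indepS I J : J \in indep M -> I \subset J -> I \in indep M.
Proof. by case: M => F /= /matroid_axiomP[_ h _]; apply: h. Qed.

Lemma indep_aug I J : I \in indep M -> J \in indep M -> #|I| < #|J| ->
  exists2 x, x \in J :\: I & x |: I \in indep M.
Proof. by case: M => F /= /matroid_axiomP[_ _]; apply. Qed.

Lemma mrank_ge I A : I \in indep M -> I \subset A -> #|I| <= mrank A.
Proof.
by move=> II IA; apply: (bigop.leq_bigmax_cond (F := fun J : {set T} => #|J|));
   rewrite II.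
Qed.

Lemma indep_ext I A : I \in indep M -> I \subset A ->
  exists J, [/\ J \in indep M, I \subset J, J \subset A & #|J| = mrank A].
Proof.
move=> II IA.
have h : exists J, [&& J \in indep M, J \subset A & I \subset J].
  by exists I; rewrite II IA /=.
have [J0 hJ0] := h; pose P := fun J => [&& J \in indep M, J \subset A & I \subset J].
pose J := [arg max_(J > J0 | P J) #|J|].
have [/and3P[JJ JA IJ] Jmax] : P J /\ forall K, P K -> #|K| <= #|J|.
  by rewrite /J; case: arg_maxnP.
exists J; split=> //; apply/eqP; rewrite eqn_leq mrank_ge //=.
apply/bigmax_leqP=> K /andP[KI KA]; rewrite leqNgt; apply/negP=> lt.
have [x /setDP[xK xJ] xI] := indep_aug JJ KI lt.
have := Jmax (x |: J); rewrite /P xI subUset sub1set (subsetP KA) // JA /=.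
by rewrite (subset_trans IJ (subsetUr _ _)) => /(_ isT); rewrite cardsU1 xJ ltnn.
Qed.

Lemma rank_basis A : exists J, [/\ J \in indep M, J \subset A & #|J| = mrank A].
Proof. by have [J [? _ ? ?]] := indep_ext indep0 (sub0set A); exists J. Qed.

Lemma mrank_le_card A : mrank A <= #|A|.
Proof. by have [J [_ JA <-]] := rank_basis A; apply: subset_leq_card. Qed.

Lemma mrankS A B : A \subset B -> mrank A <= mrank B.
Proof.
by move=> AB; have [J [? JA <-]] := rank_basis A; apply: mrank_ge;
   rewrite ?(subset_trans JA).
Qed.

Lemma indep_rank A : (A \in indep M) = (mrank A == #|A|).
Proof.
apply/idP/eqP=> [AI|e].
  by apply/eqP; rewrite eqn_leq mrank_le_card mrank_ge.
have [J [JI JA]] := rank_basis A; rewrite e => e'.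
by have /eqP <- : J == A by rewrite eqEcard JA e' leqnn.
Qed.

Lemma mrank_submod A B : mrank (A :|: B) + mrank (A :&: B) <= mrank A + mrank B.
Proof.
have [I [II IAB eI]] := rank_basis (A :&: B).
have [J [JJ IJ JU eJ]] : exists J, [/\ J \in indep M, I \subset J,
    J \subset A :|: B & #|J| = mrank (A :|: B)].
  apply: indep_ext => //; apply: subset_trans IAB _.
  by rewrite subIset // subsetUl.
have hA : #|J :&: A| <= mrank A by rewrite mrank_ge ?subsetIr // (indepS JJ) ?subsetIl.
have hB : #|J :&: B| <= mrank B by rewrite mrank_ge ?subsetIr // (indepS JJ) ?subsetIl.
have hI : #|I| <= #|(J :&: A) :&: (J :&: B)|.
  by apply: subset_leq_card; rewrite -setIIr subsetI IJ.
have hU : (J :&: A) :|: (J :&: B) = J by rewrite -setIUr; apply/setIidPl.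
have := cardsUI (J :&: A) (J :&: B); rewrite hU; lia.
Qed.

Lemma mrank1 x A : mrank (x |: A) <= (mrank A).+1.
Proof.
have := mrank_submod [set x] A.
by have := mrank_le_card [set x]; rewrite cards1; lia.
Qed.

Lemma mrankD A B : mrank (A :|: B) <= mrank A + #|B|.
Proof. by have := mrank_submod A B; have := mrank_le_card B; lia. Qed.

Lemma basesP B : reflect (B \in indep M /\ #|B| = mrank setT) (B \in bases).
Proof.
rewrite inE; apply: (iffP maxsetP) => -[BI].
  move=> Bmax; split=> //.
  have [J [JI BJ _ <-]] := indep_ext BI (subsetT B).
  by rewrite (Bmax J).
move=> e; split=> // K KI BK; apply/eqP; rewrite eq_sym eqEcard BK e.
by rewrite mrank_ge ?subsetT.
Qed.

Lemma dual_indepE X : (X \in dual_indep) = (mrank (~: X) == mrank setT).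
Proof.
rewrite inE; apply/exists_inP/eqP=> [[B /basesP[BI eB] XB]|e].
  apply/eqP; rewrite eqn_leq mrankS ?subsetT //= -eB mrank_ge //.
  by rewrite -(setCK B) setCS.
have [B [BI BX eB]] := rank_basis (~: X); exists B; last first.
  by rewrite -(setCK X) setCS.
by apply/basesP; rewrite BI -e.
Qed.

Lemma dual_matroid_axiom : matroid_axiom dual_indep.
Proof.
apply/matroid_axiomP; split=> [|I J|I J].
- by rewrite dual_indepE setC0.
- rewrite !inE => /exists_inP[B bB JB] IJ; apply/exists_inP; exists B => //.
  exact: subset_trans JB.
rewrite dual_indepE => /eqP eI; rewrite [J \in _]inE.
case/exists_inP=> B /basesP[BI eB] JB lt.
have BDI : B :\: I \subset ~: I by rewrite setDE subsetIr.
have [B' [B'I sB B'c eB']] := indep_ext (indepS BI (subsetDl B I)) BDI.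
have [x xJ xB'] : exists2 x, x \in J :\: I & x \notin B'.
  apply/exists_inP; rewrite -negb_forall_in; apply/negP=> /forall_inP h.
  have hs : (B :\: I) :|: (J :\: I) \subset B'.
    by rewrite subUset sB; apply/subsetP.
  have := subset_leq_card hs; rewrite eB' eI -eB cardsU.
  have -> : (B :\: I) :&: (J :\: I) = set0.
    apply/setP=> x; rewrite !inE; case xJ: (x \in J); rewrite ?andbF //.
    by have := subsetP JB x xJ; rewrite inE => /negPf->; rewrite andbF.
  have := cardsID I B; have := cardsID I J; rewrite cards0.
  have : #|B :&: I| + #|J :&: I| <= #|I|.
    rewrite -cardsUI -setIUl.
    have -> : (B :&: I) :&: (J :&: I) = set0.
      apply/setP=> x; rewrite !inE; case xJ: (x \in J); rewrite ?andbF //.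
      by have := subsetP JB x xJ; rewrite inE => /negPf->.
    by rewrite cards0 addn0 subset_leq_card ?subsetIr.
  lia.
exists x => //; rewrite inE; apply/exists_inP; exists B'.
  by apply/basesP; rewrite B'I eB' eI.
by rewrite subUset sub1set inE xB' -(setCK I) setCS.
Qed.

Definition dual : matroid := Matroid dual_matroid_axiom.

Lemma circuitP C :
  reflect (C \notin indep M /\ forall I, I \proper C -> I \in indep M)
          (C \in circuits).
Proof.
rewrite inE; apply: (iffP minsetP) => /= -[dC h]; split=> //.
  move=> I IC; apply: contraT => dI.
  by have := h I dI (proper_sub IC) => e; rewrite e properxx in IC.
move=> I dI sI; apply/eqP; rewrite eqEproper sI /=.
by apply: contra dI => /h.
Qed.

Lemma circuit_rank C : C \in circuits -> (mrank C).+1 = #|C|.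
Proof.
case/circuitP=> dC hC; have [x xC] : exists x, x \in C.
  by apply/set0Pn; apply: contraNneq dC => ->; exact: indep0.
have := hC _ (properD1 xC); rewrite indep_rank => /eqP e.
have := mrankS (subsetDl C [set x]); rewrite e.
have := mrank_le_card C; move: dC; rewrite indep_rank.
have := cardsD1 x C; rewrite xC; lia.
Qed.

Lemma dep_circuit A : A \notin indep M -> exists2 C, C \in circuits & C \subset A.
Proof.
move=> dA; have [C mC CA] := @minset_exists _ [pred A : {set T} | A \notin indep M] A dA.
by exists C; rewrite ?inE.
Qed.

Lemma circuit_uniq I x C D : I \in indep M -> C \in circuits -> D \in circuits ->
  C \subset x |: I -> D \subset x |: I -> C = D.
Proof.
move=> II cC cD sC sD; apply/eqP; apply: contraT => neq.
have pr : C :&: D \proper C.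
  rewrite properE subsetIl subsetI subxx /=; apply: contra neq => CD.
  rewrite eqEproper CD /=; apply/negP => pCD.
  case/circuitP: cD => _ /(_ _ pCD) CI.
  by case/circuitP: cC; rewrite CI.
have iI : C :&: D \in indep M by case/circuitP: cC => _; apply.
have := mrank_submod C D; move: iI; rewrite indep_rank => /eqP->.
have := circuit_rank cC; have := circuit_rank cD; have := cardsUI C D.
have : (C :|: D) :\ x \in indep M.
  apply: (indepS II); apply/subsetP=> y; rewrite !inE => /andP[yx /orP[]] h.
    by have := subsetP sC y h; rewrite !inE (negPf yx).
  by have := subsetP sD y h; rewrite !inE (negPf yx).
rewrite indep_rank => /eqP e.
have := mrankS (subsetDl (C :|: D) [set x]); rewrite e.
have := cardsD1 x (C :|: D); lia.
Qed.

Lemma circuit_elim z C D : C \in circuits -> D \in circuits -> C != D ->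
  z \in C :&: D -> exists2 E, E \in circuits & E \subset (C :|: D) :\ z.
Proof.
move=> cC cD neq /setIP[zC zD].
apply: dep_circuit; apply/negP => hI.
have sC : C \subset z |: (C :|: D) :\ z.
  by rewrite setD1K ?subsetUl // inE zC.
have sD : D \subset z |: (C :|: D) :\ z.
  by rewrite setD1K ?subsetUr // inE zC.
by case/eqP: neq; apply: circuit_uniq hI cC cD sC sD.
Qed.


End MatroidDef.

Lemma dual_rank (T : finType) (M : matroid T) (A : {set T}) :
  mrank M setT + mrank (dual M) A = #|A| + mrank M (~: A).
Proof.
apply/eqP; rewrite eqn_leq; apply/andP; split.
  have [Y [YI YA <-]] := rank_basis (dual M) A.
  move: YI; rewrite /= dual_indepE => /eqP <-.
  have e : ~: Y = ~: A :|: (A :\: Y).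
    apply/setP=> x; rewrite !inE; have := subsetP YA x.
    by case: (x \in Y); case: (x \in A) => // /(_ isT).
  have := mrankD M (~: A) (A :\: Y); rewrite -e.
  by have := cardsID Y A; rewrite (setIidPr YA); lia.
have [B0 [B0I B0A e0]] := rank_basis M (~: A).
have [B [BI B0B _ eB]] := indep_ext B0I (subsetT B0).
have : A :\: B \in indep (dual M).
  rewrite inE; apply/exists_inP; exists B; first exact/basesP.
  by apply/subsetP=> x; rewrite !inE => /andP[].
move/mrank_ge/(_ (subsetDl A B)).
have : #|B :&: ~: A| <= mrank M (~: A).
  by rewrite mrank_ge ?subsetIr // (indepS BI) ?subsetIl.
have : #|B0| <= #|B :&: ~: A| by rewrite subset_leq_card // subsetI B0B.
have := cardsID B A; have := cardsID A B; rewrite -setDE setIC; lia.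
Qed.
Definition is_linear_class (T : finType) (M : matroid T)
    (CL : {set {set T}}) : Prop :=
  CL \subset circuits M /\
  forall C1 C2 : {set T}, C1 \in CL -> C2 \in CL ->
    mrank M C1 + mrank M C2 = mrank M (C1 :|: C2) + mrank M (C1 :&: C2) ->
    forall C : {set T}, C \in circuits M -> C \subset C1 :|: C2 -> C \in CL.

Record linear_class (T : finType) (M : matroid T) := LinearClass {
  lc_set :> {set {set T}};
  lcP : is_linear_class M lc_set }.

Section Balance.
Variables (T : finType) (M : matroid T) (L : linear_class M).
Implicit Types (A B C D I : {set T}) (x y z : T).

Let lcS C : C \in (L : {set {set T}}) -> C \in circuits M.
Proof. by case: (lcP L) => /subsetP + _; apply. Qed.

Let lc_mod C1 C2 C : C1 \in (L : {set {set T}}) -> C2 \in (L : {set {set T}}) ->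
    mrank M C1 + mrank M C2 = mrank M (C1 :|: C2) + mrank M (C1 :&: C2) ->
    C \in circuits M -> C \subset C1 :|: C2 -> C \in (L : {set {set T}}).
Proof. by move=> h1 h2 e; case: (lcP L) => _ /(_ _ _ h1 h2 e); apply. Qed.

Let balanced A :=
  [forall C in circuits M, (C \subset A) ==> (C \in (L : {set {set T}}))].

Let balancedP A : reflect (forall C, C \in circuits M -> C \subset A ->
  C \in (L : {set {set T}})) (balanced A).
Proof.
apply: (iffP forall_inP) => h C cC; first exact/implyP/h.
by apply/implyP; apply: h.
Qed.

Lemma fundamental_balanced I A :
  I \in indep M -> I \subset A -> #|I| = mrank M A ->
  (forall x C, x \in A -> C \in circuits M -> C \subset x |: I ->
     C \in (L : {set {set T}})) ->
  forall C, C \in circuits M -> C \subset A -> C \in (L : {set {set T}}).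
Proof.
move=> II IA eI hI C cC CA.
have [k] := ubnP #|C :\: I|; elim: k => // k IHk in I II IA eI hI *.
rewrite ltnS => le_k.
have [y yCI] : exists y, y \in C :\: I.
  apply/set0Pn; rewrite setD_eq0; apply: contraL cC => CI.
  by apply/negP => /circuitP[]; rewrite (indepS II CI).
have /setDP[yC yI] := yCI.
have yA := subsetP CA y yC.
have dy : y |: I \notin indep M.
  apply: contraL (leqnn #|y |: I|) => yII; rewrite -ltnNge cardsU1 yI eI ltnS.
  have : y |: I \subset A by rewrite subUset sub1set yA.
  by move/(mrank_ge yII); rewrite cardsU1 yI eI ltnn.
have [D1 cD1 sD1] := dep_circuit dy.
have D1L : D1 \in (L : {set {set T}}) by apply: hI cD1 sD1.
have yD1 : y \in D1.
  apply: contraT => yD1; case/circuitP: cD1; rewrite (indepS II) //.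
  apply/subsetP=> t tD; have := subsetP sD1 t tD; rewrite !inE.
  by case/orP=> // /eqP ty; rewrite -ty tD in yD1.
have [sDC | /subsetPn[z zD1 zC]] := boolP (D1 \subset C).
  move: cC => /circuitP[dC hC]; have [/hC D1I|] := boolP (D1 \proper C).
    by case/circuitP: cD1; rewrite D1I.
  by rewrite properE sDC negbK => CD; have /eqP <- : D1 == C by rewrite eqEsubset sDC.
have zy : z != y by apply: contraNneq zC => ->.
have zI : z \in I by have := subsetP sD1 z zD1; rewrite !inE (negPf zy).
pose I' := y |: (I :\ z).
have I'I : I' \in indep M.
  apply: contraT => /dep_circuit[D cD sD].
  have sD' : D \subset y |: I by rewrite (subset_trans sD) // setUS // subsetDl.
  have eD := circuit_uniq II cD1 cD sD1 sD'.
  by have := subsetP sD z; rewrite -eD => /(_ zD1); rewrite !inE (negPf zy) eqxx.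
have cI' : #|I'| = #|I|.
  by rewrite cardsU1 !inE (negPf yI) andbF (cardsD1 z I) zI.
apply: (IHk I') => //.
- rewrite subUset sub1set yA; apply: subset_trans IA; exact: subsetDl.
- by rewrite cI'.
- move=> x D xA cD sD.
  have hD : D \subset y |: I -> D \in (L : {set {set T}}) by apply: hI.
  have hDx : D \subset x |: I -> D \in (L : {set {set T}}) by apply: hI.
  have [yD|yD] := boolP (y \in D); last first.
    apply: hDx; apply/subsetP=> t tD; have := subsetP sD t tD; rewrite !inE.
    have ty : t != y by apply: contraNneq yD => <-.
    by rewrite (negPf ty) /= => /orP[->|/andP[_ ->]]; rewrite ?orbT.
  have [xz|xz] := eqVneq x z.
    apply: hD; apply: subset_trans sD _; rewrite xz.
    apply/subsetP=> t; rewrite !inE => /or3P[/eqP->|->|/andP[_ ->]] //.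
    by rewrite zI orbT.
    by rewrite orbT.
  have [xI|xI] := boolP (x \in I).
    case/circuitP: cD; rewrite (indepS I'I) //; apply: subset_trans sD _.
    by rewrite subUset sub1set subxx !inE xz xI orbT.
  have xD : x \in D.
    apply: contraT => xD; case/circuitP: cD; rewrite (indepS I'I) //.
    apply/subsetP=> t tD; have := subsetP sD t tD; rewrite in_setU1.
    by case/orP=> // /eqP tx; rewrite tx (negPf xD) in tD.
  have [xy|xy] := eqVneq x y.
    case/circuitP: cD; rewrite (indepS I'I) //; apply: subset_trans sD _.
    by rewrite xy subUset sub1set subxx !inE eqxx.
  have dx : x |: I \notin indep M.
    apply/negP => xII.
    have : x |: I \subset A by rewrite subUset sub1set xA.
    by move/(mrank_ge xII); rewrite cardsU1 xI eI ltnn.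
  have [D2 cD2 sD2] := dep_circuit dx.
  have D2L : D2 \in (L : {set {set T}}) by apply: hI cD2 sD2.
  have yD2 : y \notin D2.
    by apply/negP=> /(subsetP sD2); rewrite !inE eq_sym (negPf xy) (negPf yI).
  have [zD2|zD2] := boolP (z \in D2); last first.
    suff eD : D = D2 by rewrite eD.
    apply: (circuit_uniq I'I cD cD2 sD).
    apply/subsetP=> t tD; have := subsetP sD2 t tD; rewrite !inE.
    have tz : t != z by apply: contraNneq zD2 => <-.
    by rewrite tz /= => /orP[->|->]; rewrite ?orbT.
  have xD2 : x \in D2.
    apply: contraT => xD2; case/circuitP: cD2; rewrite (indepS II) //.
    apply/subsetP=> t tD; have := subsetP sD2 t tD; rewrite in_setU1.
    by case/orP=> // /eqP tx; rewrite tx (negPf xD2) in tD.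
  have neq : D1 != D2 by apply: contraNneq yD2 => <-.
  have sI : D1 :&: D2 \subset I.
    apply/subsetP=> t /setIP[/(subsetP sD1) + /(subsetP sD2)].
    rewrite !inE => /orP[/eqP->|//]; by rewrite eq_sym (negPf xy) (negPf yI).
  have [E cE sE] : exists2 E, E \in circuits M & E \subset (D1 :|: D2) :\ z.
    by apply: circuit_elim cD1 cD2 neq _; rewrite inE zD1.
  have eE : E = D.
    apply: (circuit_uniq I'I cE cD _ sD).
    apply/subsetP=> t /(subsetP sE); rewrite in_setD1 => /andP[tz] /setUP[].
      by move/(subsetP sD1); rewrite !inE tz => /orP[->|->]; rewrite ?orbT.
    by move/(subsetP sD2); rewrite !inE tz => /orP[->|->]; rewrite ?orbT.
  apply: (lc_mod D1L D2L _ cD); last by rewrite -eE (subset_trans sE) ?subsetDl.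
  have iI := indepS II sI.
  have iU : (D1 :|: D2) :\: [set x; y] \in indep M.
    apply: (indepS II); apply/subsetP=> t; rewrite !inE negb_or.
    case/andP=> /andP[tx ty] /orP[/(subsetP sD1)|/(subsetP sD2)].
      by rewrite !inE (negPf ty).
    by rewrite !inE (negPf tx).
  have := mrank_submod M D1 D2.
  have := mrankS M (subsetDl (D1 :|: D2) [set x; y]).
  move: iI iU; rewrite !indep_rank => /eqP-> /eqP->.
  have := circuit_rank cD1; have := circuit_rank cD2; have := cardsUI D1 D2.
  have := cardsID [set x; y] (D1 :|: D2).
  have : #|(D1 :|: D2) :&: [set x; y]| <= 2.
    have := subset_leq_card (subsetIr (D1 :|: D2) [set x; y]).
    by rewrite cards2 xy.
  clear; lia.
apply: leq_trans le_k; apply: proper_card.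
apply/properP; split; last first.
  by exists y => //; rewrite !inE eqxx.
apply/subsetP=> t; rewrite !inE => /andP[]; rewrite negb_or negb_and negbK.
case/andP=> ty /orP[/eqP->|->] tC; first by rewrite tC in zC.
by rewrite tC.
Qed.

End Balance.
Section RankMatroid.
Variables (T : finType) (rk : {set T} -> nat).
Hypothesis rk0 : rk set0 = 0.
Hypothesis rk1 : forall x A, rk A <= rk (x |: A) <= (rk A).+1.
Hypothesis rk2 : forall x y A, rk (x |: A) = rk A -> rk (y |: A) = rk A ->
  rk (x |: (y |: A)) = rk A.
Implicit Types (A B I : {set T}).

Let rkcl I B : (forall x, x \in B -> rk (x |: I) = rk I) -> rk (I :|: B) = rk I.
Proof.
have [k] := ubnP #|B|; elim: k => // k IHk in I B *; rewrite ltnS => le_k hB.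
have [->|[y yB]] := set_0Vmem B; first by rewrite setU0.
have e1 := hB y yB.
rewrite -(setD1K yB) setUA [I :|: _]setUC -[RHS]e1; apply: IHk.
  by apply: leq_trans le_k; rewrite (cardsD1 y B) yB.
by move=> x /setD1P[_ xB]; rewrite e1; apply: rk2; rewrite ?e1 ?hB.
Qed.

Let rkU A B : rk A <= rk (A :|: B) <= rk A + #|B|.
Proof.
have [k] := ubnP #|B|; elim: k => // k IHk in A B *; rewrite ltnS => le_k.
have [->|[y yB]] := set_0Vmem B; first by rewrite setU0 cards0 addn0 leqnn.
rewrite -(setD1K yB) setUA [A :|: _]setUC.
have := rk1 y A; have : #|B :\ y| < k by move: le_k; rewrite (cardsD1 y B) yB.
by move/(IHk (y |: A)); rewrite cardsU1 !inE eqxx /=; lia.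
Qed.

Let rkS A B : A \subset B -> rk A <= rk B.
Proof. by move=> /setUidPr <-; case/andP: (rkU A B). Qed.

Lemma rank_matroid_axiom : matroid_axiom [set A : {set T} | rk A == #|A|].
Proof.
apply/matroid_axiomP; split; rewrite ?inE ?rk0 ?cards0 //.
  move=> I J; rewrite !inE => /eqP eJ IJ.
  have := rkU I (J :\: I); have := rkU set0 I; rewrite set0U rk0.
  have -> : I :|: J :\: I = J 
    by apply/setP=> x; rewrite !inE; case xI: (x \in I); rewrite //= (subsetP IJ).
  have := cardsID I J; rewrite (setIidPr IJ) eJ; lia.
move=> I J; rewrite !inE => /eqP eI /eqP eJ lt.
have [/exists_inP[x xJ xr]|] := boolP [exists x in J :\: I, rk (x |: I) == #|x |: I|].
  by exists x; rewrite // inE.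
rewrite negb_exists_in => /forall_inP h.
have : rk (I :|: J) = rk I.
  apply: rkcl => x xJ; have [xI|xI] := boolP (x \in I).
    by congr rk; apply/setUidPr; rewrite sub1set.
  have := h x; rewrite inE xI xJ => /(_ isT); rewrite cardsU1 xI.
  by have := rk1 x I; rewrite eI; lia.
by have := rkS (subsetUr I J); rewrite eI eJ; lia.
Qed.

Lemma rank_matroidE A : mrank (Matroid rank_matroid_axiom) A = rk A.
Proof.
have [I [II IA eI]] := rank_basis (Matroid rank_matroid_axiom) A.
rewrite -eI; have := II; rewrite inE => /eqP eI'; rewrite -eI'.
have <- : rk (I :|: A) = rk I; last by congr rk; apply/setUidPr.
apply: rkcl => x xA; have [xI|xI] := boolP (x \in I).
  by congr rk; apply/setUidPr; rewrite sub1set.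
have xIA : x |: I \subset A by rewrite subUset sub1set xA.
apply/eqP; apply: contraT => neq.
have xII : x |: I \in indep (Matroid rank_matroid_axiom).
  by rewrite inE cardsU1 xI; have := rk1 x I; move: neq; rewrite eI'; lia.
by have := mrank_ge xII xIA; rewrite -eI cardsU1 xI ltnn.
Qed.

End RankMatroid.

(* [lia] up to conversion of the ranks and cardinals *)
Local Ltac rlia :=
  repeat (let r := fresh in move: (mrank _ _) => r);
  repeat (let r := fresh in move: (#|_|) => r); clear; lia.

Section ExtendedLift.
Variable n : nat.

Definition widen_set (A : {set 'I_n}) : {set 'I_n.+1} :=
  [set widen_ord (leqnSn n) i | i in A].

(* [dual N] is the single-element extension of [dual M] by [ord_max] in the sense of
   modular cuts.  By the second conjunct, [ord_max] is not a coloop of [dual N],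
   which the third one alone would allow when [L] is empty. *)
Definition is_extended_lift (M : matroid 'I_n) (L : {set {set 'I_n}})
    (N : matroid 'I_n.+1) : bool :=
  [&& [forall A : {set 'I_n},
         (widen_set A \in indep (dual N)) == (A \in indep (dual M))],
      ord_max \in mclosure (dual N) (widen_set setT)
    & [forall H in hyperplanes (dual M),
         (ord_max \in mclosure (dual N) (widen_set H)) == (~: H \in L)]].

Variables (M : matroid 'I_n) (L : linear_class M).
Implicit Types (A B C H : {set 'I_n}) (X : {set 'I_n.+1}).

Let narrow X : {set 'I_n} := [set i | widen_ord (leqnSn n) i \in X].

Let bal A := [forall C in circuits M, (C \subset A) ==> (C \in lc_set L)].

Let rkN X := mrank M (narrow X) + ((ord_max \in X) || ~~ bal (narrow X)).

Let maxNwiden (i : 'I_n) : (ord_max == widen_ord (leqnSn n) i) = false.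
Proof. by apply/eqP=> /(congr1 val) /= e; have := ltn_ord i; rewrite -e ltnn. Qed.

Let ordSP (x : 'I_n.+1) : x = ord_max \/ exists i, x = widen_ord (leqnSn n) i.
Proof.
have [lt|ge] := ltnP x n; [right | left].
  by exists (Ordinal lt); apply: val_inj.
by apply: val_inj; apply/eqP; rewrite eqn_leq ge -ltnS ltn_ord.
Qed.

Let narrowUmax X : narrow (ord_max |: X) = narrow X.
Proof. by apply/setP=> i; rewrite !inE eq_sym maxNwiden. Qed.

Let narrowUw i X : narrow (widen_ord (leqnSn n) i |: X) = i |: narrow X.
Proof. by apply/setP=> j; rewrite !inE. Qed.

Let balP A : reflect (forall C, C \in circuits M -> C \subset A -> C \in lc_set L)
  (bal A).
Proof.
apply: (iffP forall_inP) => h C cC; first exact/implyP/h.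
by apply/implyP; apply: h.
Qed.

Let balS A B : A \subset B -> bal B -> bal A.
Proof. by move=> AB /balP h; apply/balP=> C cC /subset_trans/(_ AB); apply: h. Qed.

(* a coloop lies in no circuit *)
Let bal_coloop i A : mrank M (i |: A) != mrank M A -> bal A -> bal (i |: A).
Proof.
move=> neq /balP h; apply/balP=> C cC CA; apply: h => //.
apply/subsetP=> j jC; have := subsetP CA j jC; rewrite in_setU1 => /predU1P[ji|//].
subst j; case/eqP: neq.
have s : C :\ i \subset C :&: A.
  apply/subsetP=> j /setD1P[ji jC']; rewrite inE jC' /=.
  by have := subsetP CA j jC'; rewrite !inE (negPf ji).
have := mrank_submod M C A; have := mrankS M s.
have : i |: A \subset C :|: A by rewrite setSU // sub1set.
move/(mrankS M); have := circuit_rank cC.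
case/circuitP: cC => _ /(_ _ (properD1 jC)); rewrite indep_rank => /eqP->.
have := mrankS M (subsetUr [set i] A); rewrite (cardsD1 i C) jC; rlia.
Qed.

Let rkN1 x X : rkN X <= rkN (x |: X) <= (rkN X).+1.
Proof.
rewrite /rkN; have [->|[i ->]] := ordSP x.
  rewrite narrowUmax !inE eqxx /=; case: (_ || _); rlia.
rewrite narrowUw !inE maxNwiden /=.
have r1 := mrank1 M i (narrow X); have rS := mrankS M (subsetUr [set i] (narrow X)).
have bS := @balS (narrow X) (i |: narrow X) (subsetUr _ _).
have bc := @bal_coloop i (narrow X).
have [e|neq] := eqVneq (mrank M (i |: narrow X)) (mrank M (narrow X)); last first.
  have -> : bal (i |: narrow X) = bal (narrow X) by apply/idP/idP; [exact: bS | exact: bc].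
  by move: r1 rS; move: (mrank M (i |: _)) => a; move: (mrank M _) => b; case: (_ || _); rlia.
rewrite e; move: bS; move: (mrank M _) => a; move: (bal (narrow X)) => b; move: (bal _) => c bS.
case: (ord_max \in X) => /=; first by rlia.
by case: b c bS => [] [] //= bS; rewrite ?addn0 ?addn1 ?leqnSn ?leqnn //; have := bS isT.
Qed.

Let rkN2 x y X : rkN (x |: X) = rkN X -> rkN (y |: X) = rkN X ->
  rkN (x |: (y |: X)) = rkN X.
Proof.
have max (i : 'I_n) : rkN (widen_ord (leqnSn n) i |: X) = rkN X ->
   rkN (ord_max |: X) = rkN X ->
   rkN (widen_ord (leqnSn n) i |: (ord_max |: X)) = rkN X.
  rewrite /rkN !(narrowUw, narrowUmax) !inE maxNwiden eqxx /=.
  have := mrankS M (subsetUr [set i] (narrow X)).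
  have := @balS (narrow X) (i |: narrow X) (subsetUr _ _).
  by case: (ord_max \in X); case: (bal _); case: (bal _) => /=; rlia.
have [->|[i ->]] := ordSP x; have [->|[j ->]] := ordSP y.
- by rewrite setUA setUid.
- by move=> *; rewrite setUCA; apply: max.
- exact: max.
clear max; set A := narrow X.
rewrite /rkN !narrowUw !inE !maxNwiden /= -/A.
have ri := mrankS M (subsetUr [set i] A); have rj := mrankS M (subsetUr [set j] A).
have bi := @balS A (i |: A) (subsetUr _ _); have bj := @balS A (j |: A) (subsetUr _ _).
move=> ei ej.
have {ri}ei' : mrank M (i |: A) = mrank M A.
  by move: ri ei bi; case: (ord_max \in X); case: (bal A); case: (bal (i |: A)) => /=;
     rlia.
have {rj}ej' : mrank M (j |: A) = mrank M A.
  by move: rj ej bj; case: (ord_max \in X); case: (bal A); case: (bal (j |: A)) => /=;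
     rlia.
have eij : mrank M (i |: (j |: A)) = mrank M A.
  have := mrank_submod M (i |: A) (j |: A).
  have -> : (i |: A) :|: (j |: A) = i |: (j |: A) by rewrite setUACA setUid -setUA.
  have : A \subset (i |: A) :&: (j |: A) by rewrite subsetI !subsetUr.
  move/(mrankS M); rewrite ei' ej'.
  have := mrankS M (subsetUr [set i] (j |: A)); rewrite ej'; rlia.
move: ei ej; rewrite ei' ej' eij => /addnI ei /addnI ej; congr (_ + nat_of_bool _).
have [mX|mX] //= := boolP (ord_max \in X).
move: ei ej; rewrite (negPf mX) /= => ei ej; congr (~~ _).
have {}ei : bal (i |: A) = bal A by move: ei; case: (bal _); case: (bal _).
have {}ej : bal (j |: A) = bal A by move: ej; case: (bal _); case: (bal _).
apply/idP/idP => [|bA]; first by apply: balS; rewrite setUA subsetUr.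
have /balP hi : bal (i |: A) by rewrite ei.
have /balP hj : bal (j |: A) by rewrite ej.
have [I [II IA eI]] := rank_basis M A.
apply/balP; apply: (fundamental_balanced II).
- by rewrite (subset_trans IA) // setUA subsetUr.
- by rewrite eI eij.
move=> x0 C; rewrite !in_setU1 => h cC sC.
have sA a : C \subset a |: I -> C \subset a |: A.
  by move=> s; rewrite (subset_trans s) // setUS.
case/or3P: h => [/eqP e|/eqP e|xA]; first by apply: hi; rewrite // sA -?e.
  by apply: hj; rewrite // sA -?e.
apply: hi; rewrite // (subset_trans sC) // subUset (subset_trans IA) ?subsetUr //.
by rewrite sub1set (subsetP (subsetUr _ _) _ xA).
Qed.

Let rkN0 : rkN set0 = 0.
Proof.
rewrite /rkN inE /=; have -> : narrow set0 = set0 by apply/setP=> i; rewrite !inE.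
have -> : mrank M set0 = 0 by apply/eqP; rewrite -(cards0 'I_n) -indep_rank indep0.
suff -> : bal set0 by [].
apply/balP=> C cC; rewrite subset0 => /eqP eC.
by case/circuitP: cC; rewrite eC indep0.
Qed.

Let N : matroid 'I_n.+1 := Matroid (rank_matroid_axiom rkN0 rkN1 rkN2).

Let rN X : mrank N X = rkN X. Proof. exact: rank_matroidE. Qed.

Let narrowC A : narrow (~: widen_set A) = ~: A.
Proof.
apply/setP=> i; rewrite !inE; congr (~~ _); rewrite mem_imset //.
by move=> a b /(congr1 val) /= /val_inj.
Qed.

Let narrowCmax A : narrow (~: (ord_max |: widen_set A)) = ~: A.
Proof.
apply/setP=> i; rewrite !inE eq_sym maxNwiden /=; congr (~~ _); rewrite mem_imset //.
by move=> a b /(congr1 val) /= /val_inj.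
Qed.

Let maxNset A : ord_max \notin widen_set A.
Proof. by apply/imsetP=> -[i _ /eqP]; rewrite maxNwiden. Qed.

Let clN A : (ord_max \in mclosure (dual N) (widen_set A)) = bal (~: A).
Proof.
rewrite inE; have := dual_rank N (widen_set A).
have := dual_rank N (ord_max |: widen_set A).
rewrite !rN /rkN cardsU1 narrowC narrowCmax !inE maxNset eqxx /=.
by case: (bal _) => /= h1 h2; apply/eqP; move: h1 h2; rlia.
Qed.

Lemma extended_lift_exists : exists N, is_extended_lift M L N.
Proof.
exists N; apply/and3P; split.
- apply/forallP=> A; rewrite /= !dual_indepE !rN /rkN narrowC !inE maxNset.
  have -> : narrow setT = setT by apply/setP=> i; rewrite !inE.
  by rewrite /= eqn_add2r.
- rewrite clN setCT; apply/balP=> C cC; rewrite subset0 => /eqP eC.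
  by case/circuitP: cC; rewrite eC indep0.
apply/forall_inP=> H; rewrite inE => /andP[/eqP clH /eqP rH]; rewrite clN.
have := dual_rank M H; have := dual_rank M setT; rewrite setCT -rH.
have -> : mrank M set0 = 0 by apply/eqP; rewrite -(cards0 'I_n) -indep_rank indep0.
move=> e1 e2; have e3 := cardsC H; rewrite cardsT in e1.
have cH : ~: H \in circuits M.
  apply/circuitP; split.
    by rewrite indep_rank; apply/eqP; move: e1 e2 e3; rlia.
  move=> J /properP[JH [x]]; rewrite inE => xH xJ.
  have xcl : x \notin mclosure (dual M) H by rewrite clH.
  have : mrank (dual M) (x |: H) = (mrank (dual M) H).+1.
    have := mrank1 (dual M) x H; have := mrankS (dual M) (subsetUr [set x] H).
    by move: xcl; rewrite inE; rlia.
  have := dual_rank M (x |: H); rewrite cardsU1 xH /=.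
  have sJ : J \subset ~: (x |: H).
    apply/subsetP=> t tJ; rewrite !inE negb_or; have := subsetP JH t tJ.
    by rewrite inE => ->; rewrite andbT; apply: contraNneq xJ => <-.
  move=> e4 e5; apply: indepS sJ; rewrite indep_rank; apply/eqP.
  have := cardsC (x |: H); rewrite cardsU1 xH /=.
  by move: e1 e2 e3 e4 e5; rlia.
apply/eqP; apply/idP/idP => [/balP h|HL]; first exact: h.
apply/balP=> C cC CH.
suff /eqP-> : C == ~: H by [].
rewrite eqEproper CH /=; apply/negP => /(proj2 (circuitP _ _ cH)).
by case/circuitP: cC => /negPf->.
Qed.

Definition extended_lift : matroid 'I_n.+1 := xchoose extended_lift_exists.

Lemma extended_liftP : is_extended_lift M L extended_lift.
Proof. exact: xchooseP. Qed.

End ExtendedLift.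
Import GRing.Theory.
Local Open Scope ring_scope.

(* The exterior algebra on [n] generators: an element is stored by its coordinates
   in the basis of the monomials [ext_e X]. *)

Definition ext (K : fieldType) (n : nat) : Type := {ffun {set 'I_n} -> K^o}.

Section Exterior.
Variables (K : fieldType) (n : nat).
Local Notation E := (ext K n).
Implicit Types (A B C X : {set 'I_n}) (x y z : E).

HB.instance Definition _ := Vector.copy E {ffun {set 'I_n} -> K^o}.

Definition ext_e X : E := [ffun A => (A == X)%:R].

Definition inversions A B : nat := (\sum_(i in A) \sum_(j in B) (j < i))%N.

Definition shuffle_sign A B : K :=
  if [disjoint A & B] then (-1) ^+ inversions A B else 0.

Definition ext_mul x y : E :=
  \sum_A \sum_B (x A * y B * shuffle_sign A B) *: ext_e (A :|: B).

Lemma ext_expand x : x = \sum_A x A *: ext_e A.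
Proof.
apply/ffunP=> A; rewrite sum_ffunE (bigD1 A) //= big1 => [|B neq].
  by rewrite !ffunE eqxx addr0 [_ *: _]mulr1.
by rewrite !ffunE eq_sym (negPf neq) [_ *: _]mulr0.
Qed.

Let ext_mulDl : left_distributive ext_mul +%R.
Proof.
move=> x y z; rewrite /ext_mul -big_split; apply: eq_bigr => A _ /=.
rewrite -big_split; apply: eq_bigr => B _ /=.
by rewrite -scalerDl ffunE -!mulrDl.
Qed.

Let ext_mulDr : right_distributive ext_mul +%R.
Proof.
move=> x y z; rewrite /ext_mul -big_split; apply: eq_bigr => A _ /=.
rewrite -big_split; apply: eq_bigr => B _ /=.
by rewrite -scalerDl ffunE mulrDr mulrDl.
Qed.

Let ext_scalerAl (k : K) x y : k *: ext_mul x y = ext_mul (k *: x) y.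
Proof.
rewrite /ext_mul scaler_sumr; apply: eq_bigr => A _.
rewrite scaler_sumr; apply: eq_bigr => B _.
by rewrite scalerA ffunE !mulrA.
Qed.

Let ext_scalerAr (k : K) x y : k *: ext_mul x y = ext_mul x (k *: y).
Proof.
rewrite /ext_mul scaler_sumr; apply: eq_bigr => A _.
rewrite scaler_sumr; apply: eq_bigr => B _.
by rewrite scalerA ffunE !mulrA [k * x A]mulrC.
Qed.

Let ext_mulee A B : ext_mul (ext_e A) (ext_e B) = shuffle_sign A B *: ext_e (A :|: B).
Proof.
rewrite /ext_mul (bigD1 A) //= (bigD1 B) //= !ffunE !eqxx !mul1r !big1 ?addr0 //.
  by move=> C neq; apply: big1 => D _; rewrite !ffunE (negPf neq) !mul0r scale0r.
by move=> C neq; rewrite !ffunE (negPf neq) mulr0 mul0r scale0r.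
Qed.

Lemma inversionsUl A B C : [disjoint A & B] ->
  inversions (A :|: B) C = (inversions A C + inversions B C)%N.
Proof.
by move=> dAB; rewrite /inversions (eq_bigl [predU A & B]) ?bigU //=
   => i; rewrite !inE.
Qed.

Lemma inversionsUr A B C : [disjoint B & C] ->
  inversions A (B :|: C) = (inversions A B + inversions A C)%N.
Proof.
move=> dBC; rewrite /inversions -big_split; apply: eq_bigr => i _ /=.
by rewrite (eq_bigl [predU B & C]) ?bigU //= => j; rewrite !inE.
Qed.

Let shuffle_signA A B C :
  shuffle_sign A B * shuffle_sign (A :|: B) C =
  shuffle_sign B C * shuffle_sign A (B :|: C).
Proof.
rewrite /shuffle_sign -!setI_eq0 setIUl setIUr !setU_eq0 !setI_eq0.
have [dAB|] := boolP [disjoint A & B]; rewrite ?mul0r ?mulr0 //=; last first.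
have [dBC|] := boolP [disjoint B & C]; rewrite ?mul0r ?andbF ?mulr0 //=.
rewrite andbT; case: ifP => _; rewrite ?mulr0 //.
by rewrite inversionsUl // inversionsUr // -!exprD addnA addnC.
Qed.

(* a bilinear product is determined by its values on the monomials *)
Section Bilinear.
Variables (op : E -> E -> E).
Hypothesis opDl : left_distributive op +%R.
Hypothesis opDr : right_distributive op +%R.
Hypothesis opZl : forall (k : K) x y, k *: op x y = op (k *: x) y.
Hypothesis opZr : forall (k : K) x y, k *: op x y = op x (k *: y).

Let op0l y : op 0 y = 0.
Proof. by rewrite -[0 in LHS](scale0r (0 : E)) -opZl scale0r. Qed.

Let op0r x : op x 0 = 0.
Proof. by rewrite -[0 in LHS](scale0r (0 : E)) -opZr scale0r. Qed.

Let op_expl x y : op x y = \sum_A x A *: op (ext_e A) y.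
Proof.
rewrite {1}(ext_expand x).
rewrite (big_morph (fun x => op x y) (fun a b => opDl a b y) (op0l y)).
by apply: eq_bigr => A _; rewrite opZl.
Qed.

Let op_expr x y : op x y = \sum_A y A *: op x (ext_e A).
Proof.
rewrite {1}(ext_expand y) (big_morph (op x) (opDr x) (op0r x)).
by apply: eq_bigr => A _; rewrite opZr.
Qed.

Let op_suml (c : {set 'I_n} -> K) (F : {set 'I_n} -> E) y :
  op (\sum_A c A *: F A) y = \sum_A c A *: op (F A) y.
Proof.
rewrite (big_morph (fun x => op x y) (fun a b => opDl a b y) (op0l y)).
by apply: eq_bigr => A _; rewrite opZl.
Qed.

Let op_sumr (c : {set 'I_n} -> K) (F : {set 'I_n} -> E) x :
  op x (\sum_A c A *: F A) = \sum_A c A *: op x (F A).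
Proof.
rewrite (big_morph (op x) (opDr x) (op0r x)).
by apply: eq_bigr => A _; rewrite opZr.
Qed.

Lemma ext_bilinear_assoc :
  (forall A B C, op (ext_e A) (op (ext_e B) (ext_e C)) =
                 op (op (ext_e A) (ext_e B)) (ext_e C)) -> associative op.
Proof.
move=> h x y z.
rewrite (op_expl x (op y z)) (op_expl x y) op_suml; apply: eq_bigr => A _.
congr (_ *: _); rewrite (op_expl y z) (op_expr (ext_e A) y) op_suml op_sumr.
apply: eq_bigr => B _; congr (_ *: _).
rewrite (op_expr (ext_e B) z) op_sumr (op_expr _ z).
by apply: eq_bigr => C _; rewrite h.
Qed.

Lemma ext_bilinear_id e :
  (forall A, op e (ext_e A) = ext_e A) -> left_id e op.
Proof.
by move=> h x; rewrite op_expr [RHS]ext_expand; apply: eq_bigr => A _; rewrite h.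
Qed.

Lemma ext_bilinear_idr e :
  (forall A, op (ext_e A) e = ext_e A) -> right_id e op.
Proof.
by move=> h x; rewrite op_expl [RHS]ext_expand; apply: eq_bigr => A _; rewrite h.
Qed.

End Bilinear.

Let ext_mulA : associative ext_mul.
Proof.
apply: (ext_bilinear_assoc ext_mulDl ext_mulDr ext_scalerAl ext_scalerAr) => A B C.
rewrite !ext_mulee -ext_scalerAl -ext_scalerAr !ext_mulee !scalerA setUA.
by rewrite shuffle_signA.
Qed.

Let ext_mul1x : left_id (ext_e set0) ext_mul.
Proof.
apply: (ext_bilinear_id ext_mulDr ext_scalerAr) => A; rewrite ext_mulee set0U.
by rewrite /shuffle_sign -setI_eq0 set0I eqxx /inversions big_set0 expr0 scale1r.
Qed.

Let ext_mulx1 : right_id (ext_e set0) ext_mul.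
Proof.
apply: (ext_bilinear_idr ext_mulDl ext_scalerAl) => A; rewrite ext_mulee setU0.
rewrite /shuffle_sign -setI_eq0 setI0 eqxx /inversions big1 ?expr0 ?scale1r // => i _.
by rewrite big_set0.
Qed.

Let ext_oner_neq0 : ext_e set0 != 0.
Proof.
by apply/eqP=> /ffunP/(_ set0)/eqP; rewrite !ffunE eqxx oner_eq0.
Qed.

HB.instance Definition _ := GRing.Zmodule_isNzRing.Build E
  ext_mulA ext_mul1x ext_mulx1 ext_mulDl ext_mulDr ext_oner_neq0.
HB.instance Definition _ := GRing.Lmodule_isLalgebra.Build K E ext_scalerAl.
HB.instance Definition _ := GRing.Lalgebra_isAlgebra.Build K E ext_scalerAr.
HB.instance Definition _ := Algebra_isFalgebra.Build K E.

Lemma ext_e0 : ext_e set0 = 1. Proof. by []. Qed.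

Lemma ext_mulE A B : ext_e A * ext_e B = shuffle_sign A B *: ext_e (A :|: B).
Proof. exact: ext_mulee. Qed.

(* [enum X] is increasing, so [ext_e X] is the ordered product of its generators *)
Lemma ext_e_prod X : ext_e X = \prod_(i <- enum X) ext_e [set i].
Proof.
have : sorted ltn [seq val i | i <- enum X].
  have s : subseq [seq val i | i <- enum X] [seq val i | i <- enum 'I_n].
    by rewrite map_subseq // /enum_mem filter_predT filter_subseq.
  by apply: (subseq_sorted ltn_trans s); rewrite val_enum_ord iota_ltn_sorted.
move=> srt; have {1}-> : X = [set i in enum X] by apply/setP=> i; rewrite inE mem_enum.
elim: (enum X) srt => [_|i s IHs] /=.
  by rewrite big_nil -ext_e0; congr ext_e; apply/setP=> i; rewrite !inE.
move=> ps; rewrite big_cons -IHs ?(path_sorted ps) // ext_mulE.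
have h j : j \in s -> (i < j)%N.
  move=> js; have /allP := order_path_min ltn_trans ps.
  by apply; apply: map_f.
rewrite /shuffle_sign disjoints1 !inE; case: ifPn => [is_|].
  rewrite /inversions big_set1 big1 => [|j].
    rewrite expr0 scale1r; congr ext_e; apply/setP=> j; rewrite !inE //.
  by rewrite inE => /h; rewrite ltnNge => /negPf; rewrite leq_eqVlt; case: ltngtP.
by rewrite negbK => /h; rewrite ltnn.
Qed.

(* the sign is [(-1) ^+ k] when [i] is the [k]-th element of [X], counting from 1 *)
Definition ext_d x : E :=
  \sum_X x X *: \sum_(i in X) (-1) ^+ #|[set j in X | (j <= i)%N]| *: ext_e (X :\ i).

Lemma ext_d_e X : ext_d (ext_e X) =
  \sum_(i in X) (-1) ^+ #|[set j in X | (j <= i)%N]| *: ext_e (X :\ i).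
Proof.
rewrite /ext_d (bigD1 X) //= ffunE eqxx scale1r [X in _ + X]big1 ?addr0 // => Y neq.
by rewrite ffunE (negPf neq) scale0r.
Qed.

Fact ext_d_linear : linear ext_d.
Proof.
move=> k x y; rewrite /ext_d scaler_sumr -big_split; apply: eq_bigr => X _ /=.
by rewrite !ffunE scalerDl scalerA.
Qed.

HB.instance Definition _ := GRing.isLinear.Build K E E _ ext_d ext_d_linear.

End Exterior.
Section Ideals.
Variables (K : fieldType) (A : falgType K).

(* as [A] has a unit, this is the smallest two-sided ideal containing [s] *)
Definition ideal_gen (s : seq A) : {vspace A} := ({:A} * <<s>> * {:A})%VS.

Record proper_ideal := ProperIdeal {
  ideal_vspace :> {vspace A};
  ideal_mull : forall x y : A, y \in ideal_vspace -> x * y \in ideal_vspace;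
  ideal_mulr : forall x y : A, x \in ideal_vspace -> x * y \in ideal_vspace;
  ideal_proper : 1 \notin ideal_vspace }.

Lemma ideal_gen_mull s x y : y \in ideal_gen s -> x * y \in ideal_gen s.
Proof.
move=> ys; rewrite /ideal_gen.
have : x * y \in ({:A} * ideal_gen s)%VS by rewrite memv_mul ?memvf.
by apply: subvP; rewrite /ideal_gen !prodvA prodvSl // prodvSl // subvf.
Qed.

Lemma ideal_gen_mulr s x y : x \in ideal_gen s -> x * y \in ideal_gen s.
Proof.
move=> xs; rewrite /ideal_gen.
have : x * y \in (ideal_gen s * {:A})%VS by rewrite memv_mul ?memvf.
by apply: subvP; rewrite /ideal_gen -prodvA prodvSr // subvf.
Qed.

Lemma mem_ideal_gen (s : seq A) x : x \in s -> x \in ideal_gen s.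
Proof.
by move=> xs; rewrite -[x]mulr1 -[x]mul1r !memv_mul ?memvf ?memv_span.
Qed.

Lemma ideal_gen_min (s : seq A) (I : {vspace A}) :
  (forall x y : A, y \in I -> x * y \in I) ->
  (forall x y : A, x \in I -> x * y \in I) ->
  {subset s <= I} -> (ideal_gen s <= I)%VS.
Proof.
move=> Il Ir sI; apply/prodvP=> u y us _; apply: Ir; move: u us.
apply/subvP/prodvP=> x v _ vs; apply: Il; move: v vs.
by apply/subvP/span_subvP.
Qed.

(* a character of [A] that kills the generators witnesses properness *)
Lemma ideal_gen_proper (s : seq A) (eps : {linear A -> K^o}) :
  eps 1 = 1 -> {morph eps : x y / x * y} ->
  {in s, forall x, eps x = 0} -> 1 \notin ideal_gen s.
Proof.
move=> eps1 epsM epss.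
have kerE x : (x \in lker (linfun eps)) = (eps x == 0) by rewrite memv_ker lfunE.
suff /subvP h : (ideal_gen s <= lker (linfun eps))%VS.
  by apply/negP=> /h; rewrite kerE eps1 oner_eq0.
apply: ideal_gen_min => x; last by rewrite kerE => /epss->.
- by move=> y; rewrite !kerE epsM => /eqP->; rewrite mulr0.
- by move=> y; rewrite !kerE epsM => /eqP->; rewrite mul0r.
Qed.

Definition ideal_gen_pideal (s : seq A) (h : 1 \notin ideal_gen s) : proper_ideal :=
  ProperIdeal (@ideal_gen_mull s) (@ideal_gen_mulr s) h.

End Ideals.

(* The class of [x] modulo [I] is stored as its component in the complement
   [I^C] of [I]. *)
Definition quotient_alg (K : fieldType) (A : falgType K) (I : proper_ideal A) : Type :=
  subvs_of (I^C)%VS.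

Section Quotient.
Variables (K : fieldType) (A : falgType K) (I : proper_ideal A).
Local Notation Q := (quotient_alg I).

HB.instance Definition _ := Vector.copy Q (subvs_of (I^C)%VS).

Definition quotient_pi (x : A) : Q := vsproj (I^C)%VS (daddv_pi (I^C)%VS I x).
Let rep (q : Q) : A := vsval q.

Let capIC : ((I^C) :&: I = 0)%VS. Proof. by rewrite capvC capv_compl. Qed.

Fact quotient_pi_linear : linear quotient_pi.
Proof. by move=> k x y; rewrite /quotient_pi !linearP. Qed.

HB.instance Definition _ := GRing.isLinear.Build K A Q _ quotient_pi quotient_pi_linear.

Let repK q : quotient_pi (rep q) = q.
Proof.
by rewrite /quotient_pi daddv_pi_id ?capIC ?subvsP // vsvalK.
Qed.

Let rep_pi x : rep (quotient_pi x) - x \in ideal_vspace I.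
Proof.
rewrite /rep /quotient_pi vsprojK ?memv_pi //.
have e : daddv_pi (I^C)%VS I x + daddv_pi I (I^C)%VS x = x.
  by apply: daddv_pi_add; rewrite ?capIC // addvC addv_complf memvf.
by rewrite -[X in _ - X]e opprD addrA subrr add0r memvN memv_pi.
Qed.

Lemma quotient_pi_eq0 x : (quotient_pi x == 0) = (x \in ideal_vspace I).
Proof.
apply/eqP/idP => [e|xI].
  by have := rep_pi x; rewrite e /rep linear0 sub0r memvN.
apply: val_inj; rewrite /= vsprojK ?memv_pi //.
have e : daddv_pi (I^C)%VS I x + daddv_pi I (I^C)%VS x = x.
  by apply: daddv_pi_add; rewrite ?capIC // addvC addv_complf memvf.
rewrite [X in _ + X](daddv_pi_id (capv_compl I) xI) in e.
by apply: (addIr x); exact: (etrans e (esym (add0r x))).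
Qed.

Let eqmod x y : x - y \in ideal_vspace I -> quotient_pi x = quotient_pi y.
Proof. by rewrite -quotient_pi_eq0 linearB subr_eq0 => /eqP. Qed.

Lemma quotient_pi_surj q : exists x, quotient_pi x = q.
Proof. by exists (rep q). Qed.

Definition quotient_mul (p q : Q) : Q := quotient_pi (rep p * rep q).

Let piM x y : quotient_pi (x * y) = quotient_mul (quotient_pi x) (quotient_pi y).
Proof.
apply/esym/eqmod; rewrite (_ : _ - _ = (rep (quotient_pi x) - x) * rep (quotient_pi y)
  + x * (rep (quotient_pi y) - y)).
  by apply: memvD; [apply: ideal_mulr | apply: ideal_mull]; exact: rep_pi.
by rewrite mulrBl mulrBr addrA subrK.
Qed.

Let quotient_mulA : associative quotient_mul.
Proof.
by move=> p q r; rewrite -(repK p) -(repK q) -(repK r) -!piM mulrA.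
Qed.

Let quotient_mul1q : left_id (quotient_pi 1) quotient_mul.
Proof. by move=> q; rewrite -(repK q) -piM mul1r. Qed.

Let quotient_mulq1 : right_id (quotient_pi 1) quotient_mul.
Proof. by move=> q; rewrite -(repK q) -piM mulr1. Qed.

Let quotient_mulDl : left_distributive quotient_mul +%R.
Proof.
by move=> p q r; rewrite -(repK p) -(repK q) -(repK r) -linearD -!piM mulrDl linearD.
Qed.

Let quotient_mulDr : right_distributive quotient_mul +%R.
Proof.
by move=> p q r; rewrite -(repK p) -(repK q) -(repK r) -linearD -!piM mulrDr linearD.
Qed.

Let quotient_oner_neq0 : quotient_pi 1 != 0.
Proof. by rewrite quotient_pi_eq0 ideal_proper. Qed.

Let quotient_scalerAl (k : K) (p q : Q) :
  k *: quotient_mul p q = quotient_mul (k *: p) q.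
Proof. by rewrite -(repK p) -(repK q) -piM -linearZ /= scalerAl piM linearZ. Qed.

Let quotient_scalerAr (k : K) (p q : Q) :
  k *: quotient_mul p q = quotient_mul p (k *: q).
Proof. by rewrite -(repK p) -(repK q) -piM -linearZ /= scalerAr piM linearZ. Qed.

HB.instance Definition _ := GRing.Zmodule_isNzRing.Build Q quotient_mulA
  quotient_mul1q quotient_mulq1 quotient_mulDl quotient_mulDr quotient_oner_neq0.
HB.instance Definition _ := GRing.Lmodule_isLalgebra.Build K Q quotient_scalerAl.
HB.instance Definition _ := GRing.Lalgebra_isAlgebra.Build K Q quotient_scalerAr.
HB.instance Definition _ := Algebra_isFalgebra.Build K Q.

Fact quotient_pi_monoid : monoid_morphism quotient_pi.
Proof. by split=> [|x y]; [|exact: piM]. Qed.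

HB.instance Definition _ :=
  GRing.isMonoidMorphism.Build A Q quotient_pi quotient_pi_monoid.

(* a character of [A] that vanishes on [I] factors through the quotient *)
Lemma quotient_factor (eps : {linear A -> K^o}) :
  eps 1 = 1 -> {morph eps : x y / x * y} ->
  {in ideal_vspace I, forall x, eps x = 0} ->
  exists eps' : {linear Q -> K^o},
    [/\ eps' 1 = 1, {morph eps' : p q / p * q}
      & forall x, eps' (quotient_pi x) = eps x].
Proof.
move=> eps1 epsM epsI; pose f : {linear Q -> K^o} := eps \o (vsval : {linear Q -> A}).
have fpi x : f (quotient_pi x) = eps x.
  have /eqP : eps (rep (quotient_pi x) - x) = 0 by apply/epsI/rep_pi.
  by rewrite linearB subr_eq0 => /eqP.
exists f; split=> //; first exact: (etrans (fpi 1)).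
by move=> p q; rewrite -(repK p) -(repK q) -rmorphM !fpi epsM.
Qed.

End Quotient.

Section OrlikSolomon.
Variables (K : fieldType) (n : nat).

Definition ext_coef0 (x : ext K n) : K^o := x set0.

Fact ext_coef0_linear : linear ext_coef0.
Proof. by move=> k x y; rewrite /ext_coef0 !ffunE. Qed.

HB.instance Definition _ :=
  GRing.isLinear.Build K (ext K n) K^o _ ext_coef0 ext_coef0_linear.

Lemma ext_coef0_1 : ext_coef0 1 = 1.
Proof. by rewrite -ext_e0 /ext_coef0 ffunE eqxx. Qed.

Lemma ext_coef0_e (X : {set 'I_n}) : X != set0 -> ext_coef0 (ext_e K X) = 0.
Proof. by move=> X0; rewrite /ext_coef0 ffunE eq_sym (negPf X0). Qed.

Lemma ext_coef0M : {morph ext_coef0 : x y / x * y}.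
Proof.
have coefl x B : ext_coef0 (x * ext_e K B) = ext_coef0 x * ext_coef0 (ext_e K B).
  rewrite (ext_expand x) mulr_suml !linear_sum mulr_suml; apply: eq_bigr => A _.
  rewrite -scalerAl !linearZ /= -!mulrA; congr (_ * _).
  rewrite ext_mulE linearZ /=.
  have [->|A0] := eqVneq A set0.
    rewrite set0U ext_e0 ext_coef0_1 mul1r /shuffle_sign -setI_eq0 set0I eqxx.
    by rewrite /inversions big_set0 expr0 scale1r.
  have U0 : A :|: B != set0 by rewrite setU_eq0 negb_and A0.
  by rewrite (ext_coef0_e A0) (ext_coef0_e U0) mul0r scaler0.
move=> x y; rewrite (ext_expand y) mulr_sumr !linear_sum mulr_sumr.
apply: eq_bigr => B _; rewrite -scalerAr !linearZ /= coefl.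
by rewrite mulrCA.
Qed.

Lemma ext_coef0_d (X : {set 'I_n}) : (1 < #|X|)%N -> ext_coef0 (ext_d (ext_e K X)) = 0.
Proof.
move=> X1; rewrite ext_d_e linear_sum big1 // => i iX.
rewrite linearZ /= ext_coef0_e ?scaler0 //.
by rewrite -card_gt0; move: X1; rewrite (cardsD1 i) iX.
Qed.

Variable N : matroid 'I_n.

Definition OS_gens : seq (ext K n) :=
  [seq ext_d (ext_e K C) | C : {set 'I_n} in [set C in circuits N | (1 < #|C|)%N]] ++
  [seq ext_e K C | C : {set 'I_n} in circuits N].

Lemma OS_gens_coef0 : {in OS_gens, forall x, ext_coef0 x = 0}.
Proof.
move=> x; rewrite mem_cat => /orP[] /imageP[C].
  by rewrite inE => /andP[_ C1] ->; apply: ext_coef0_d.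
move=> cC ->; apply: ext_coef0_e.
by apply: contraTneq cC => ->; apply/negP=> /circuitP[]; rewrite indep0.
Qed.

Lemma OS_proper : 1 \notin ideal_gen OS_gens.
Proof. exact: (ideal_gen_proper ext_coef0_1 ext_coef0M OS_gens_coef0). Qed.

Definition OS_ideal : proper_ideal (ext K n) := ideal_gen_pideal OS_proper.

Definition OS : falgType K := quotient_alg OS_ideal.

Definition OS_e (X : {set 'I_n}) : OS := quotient_pi OS_ideal (ext_e K X).

End OrlikSolomon.

Section BiasAlgebra.
Variables (K : fieldType) (n : nat) (M : matroid 'I_n) (L : linear_class M).

Let N := extended_lift L.

Definition bias_gens : seq (OS K N) := [:: OS_e K N [set ord_max]].

Lemma bias_proper : 1 \notin ideal_gen bias_gens.
Proof.
have [|eps [eps1 epsM epspi]] :=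
    @quotient_factor _ _ (OS_ideal K N) (@ext_coef0 K n.+1) (ext_coef0_1 _ _) (@ext_coef0M _ _).
  move=> x xI; have kerE y : (y \in lker (linfun (@ext_coef0 K n.+1))) = (ext_coef0 y == 0).
    by rewrite memv_ker lfunE.
  apply/eqP; rewrite -kerE; move: x xI; apply/subvP; apply: ideal_gen_min => x.
  - by move=> y; rewrite !kerE ext_coef0M => /eqP->; rewrite mulr0.
  - by move=> y; rewrite !kerE ext_coef0M => /eqP->; rewrite mul0r.
  - by move/OS_gens_coef0; rewrite kerE => ->.
apply: (ideal_gen_proper eps1 epsM) => x; rewrite inE => /eqP->.
by rewrite epspi; apply: ext_coef0_e; rewrite -card_gt0 cards1.
Qed.

Definition bias_ideal : proper_ideal (OS K N) := ideal_gen_pideal bias_proper.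

Definition bias_algebra : falgType K := quotient_alg bias_ideal.

(* image of [ext_e X], for [X] a subset of the ground set of [M] *)
Definition bias_e (X : {set 'I_n}) : bias_algebra :=
  quotient_pi bias_ideal (OS_e K N (widen_set X)).

End BiasAlgebra.

Section BrokenCircuits.
Variables (n : nat) (M : matroid 'I_n) (L : {set {set 'I_n}}).
Implicit Types (B C I U X : {set 'I_n}) (x : 'I_n).

Definition is_min x X : bool := (x \in X) && [forall y in X, (x <= y)%N].

(* the circuit contained in [U], when there is exactly one; both [C(x, I)] (with
   [U = x |: I]) and [C(U)] are of this form *)
Definition circuit_in U : {set 'I_n} :=
  odflt set0 [pick C in circuits M | C \subset U].

Definition actives I : {set 'I_n} :=
  [set x | [&& [set x] \in indep M, x \in mclosure M I :\: I,
               circuit_in (x |: I) \in L & is_min x (circuit_in (x |: I))]].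

Definition unidependent U : bool :=
  [&& #|[set C in circuits M | C \subset U]| == 1%N,
      circuit_in U \in L & (1 < #|circuit_in U|)%N].

Definition inactive U : bool :=
  [exists x, is_min x (circuit_in U) && is_min x (actives (U :\ x))].

Definition broken_circuit B : bool :=
  [exists C in L, (1 < #|C|)%N && [exists x, is_min x C && (B == C :\ x)]].

Definition NBC : {set {set 'I_n}} :=
  [set I in indep M | [forall B, broken_circuit B ==> ~~ (B \subset I)]].

Variable K : fieldType.

Definition Im_gens : seq (ext K n) :=
  [seq ext_d (ext_e K C) | C : {set 'I_n} in [set C in L | (1 < #|C|)%N]] ++
  [seq ext_e K C | C : {set 'I_n} in circuits M].

Definition Im_basis : seq (ext K n) :=
  [seq ext_d (ext_e K U) | U : {set 'I_n} in [set U | unidependent U && inactive U]] ++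
  [seq ext_e K D | D : {set 'I_n} in [set D | D \notin indep M]].

End BrokenCircuits.

(* Main.v *)
(** Write [S] for the span of [Im_basis]. Every monomial [e_X] is, modulo [S], a
    combination of [nbc] monomials: if [a] is the smallest active element of the
    independent set [X] and [U = a |: X], then [d e_U] expresses [e_X] through the
    [e_(U \ y)] with [y > a], whose element sum is smaller, and through dependent
    monomials. As [U |-> U \ min C(U)] embeds the inactive unidependent sets into
    the independent sets outside [NBC], [nbc] and [Im_basis] together have at most
    [2 ^ n] elements, hence form a basis of the exterior algebra.

    To see that [S] is the ideal, it suffices that [d e_U] lies in [S] for every
    unidependent [U]. If [U] is not inactive, the smallest active element [b] of
    [U \ min C(U)] is less than [min C(U)], and [d (d e_(b |: U)) = 0] expresses
    [d e_U] through the [d e_((b |: U) \ y)]: for [y < b] this set contains two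
    circuits, so only dependent monomials occur; for [y > b] its element sum is
    smaller, and its circuits lie in the linear class.

    Finally the bias algebra is the quotient of the exterior algebra by this same
    ideal, because the extended lift has rank function
    [r(A) + [n+1 in X or A contains a circuit outside the class]] at [X], where
    [A] is the trace of [X] on [n]. *)
From HB Require Import structures.
Require Import Defs.
From mathcomp Require Import all_boot all_order all_algebra all_field.
From mathcomp Require Import zify.
Set Implicit Arguments.
Unset Strict Implicit.
Unset Printing Implicit Defensive.

(* [lia] up to conversion of the ranks and cardinals *)
Local Ltac rlia :=
  repeat (let r := fresh in move: (mrank _ _) => r);
  repeat (let r := fresh in move: (#|_|) => r); clear; lia.

(** * Nullity, circuits and active elements *)

Section Nullity.
Variables (T : finType) (M : matroid T).
Implicit Types (A B C D I U : {set T}) (x y : T).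

Lemma mrank0 : mrank M set0 = 0.
Proof. by apply/eqP; rewrite -leqn0 -(cards0 T) mrank_le_card. Qed.

Lemma circuit_nonempty C : C \in circuits M -> exists x, x \in C.
Proof.
by move=> cC; apply/set0Pn; apply: contraTneq cC => ->; apply/negP=> /circuitP[]; rewrite indep0.
Qed.

Lemma circuit_dep A C : C \in circuits M -> C \subset A -> A \notin indep M.
Proof. by case/circuitP=> dC _ CA; apply: contra dC => /indepS; apply. Qed.

Lemma circuitD1_indep C x : C \in circuits M -> x \in C -> C :\ x \in indep M.
Proof. by case/circuitP=> _ h xC; apply/h/properD1. Qed.

Lemma set1_circuit C x : C \in circuits M -> x \in C -> 1 < #|C| ->
  [set x] \in indep M.
Proof.
case/circuitP=> _ h xC C1; apply: h; rewrite properEcard sub1set xC cards1 //.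
Qed.

Lemma dep_rank A : A \notin indep M -> mrank M A < #|A|.
Proof. by rewrite indep_rank ltn_neqAle mrank_le_card andbT. Qed.

(** A basis of a set of nullity at most one misses at most one of its elements, so [circuit_uniq]
    applies. The bound [#|A| <= (mrank M A).+1] serves below as the working form of having at most
    one circuit. *)
Lemma circuit_unique A C D : #|A| <= (mrank M A).+1 -> C \in circuits M ->
  D \in circuits M -> C \subset A -> D \subset A -> C = D.
Proof.
move=> hA cC cD CA DA; have [I [II IA eI]] := rank_basis M A.
have [x eA] : exists x, A \subset x |: I.
  have := cardsID I A; rewrite (setIidPr IA) => e.
  have [/eqP|[x xAI]] := set_0Vmem (A :\: I).
    rewrite setD_eq0 => AI; case/negP: (circuit_dep cC CA); exact: indepS AI.
  exists x; have h : [set x] == A :\: I.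
    rewrite eqEcard sub1set xAI cards1; lia.
  by rewrite (eqP h); apply/subsetP=> y yA; rewrite !inE yA andbT orNb.
by apply: (circuit_uniq II cC cD); apply: subset_trans eA.
Qed.

(** Deleting one element lowers the nullity by at most one. *)
Lemma nullity2_dep A x : (mrank M A).+1 < #|A| -> A :\ x \notin indep M.
Proof.
move=> hA; rewrite indep_rank neq_ltn; apply/orP; left.
have := mrankS M (subsetDl A [set x]); have := cardsD1 x A.
by case: (x \in A) => /=; lia.
Qed.

Lemma indepU1_rank I x : I \in indep M -> #|x |: I| <= (mrank M (x |: I)).+1.
Proof.
rewrite indep_rank => /eqP e; have := mrankS M (subsetUr [set x] I).
by rewrite e cardsU1; case: (x \in I) => /=; lia.
Qed.

(** Otherwise augmentation would enlarge a basis of [A] by some [x], against [x] lying in the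
    closure. *)
Lemma mclosure_setT A :
  (forall x, x \in mclosure M A) -> mrank M A = mrank M setT.
Proof.
move=> h; apply/eqP; rewrite eqn_leq mrankS ?subsetT //= leqNgt; apply/negP => lt.
have [I [II IA eI]] := rank_basis M A; have [J [JI _ eJ]] := rank_basis M setT.
rewrite -eI -eJ in lt; have [x /setDP[_ xI] xII] := indep_aug II JI lt.
have : x |: I \subset x |: A by rewrite setUS.
move/(mrank_ge xII); have := h x; rewrite inE => /eqP->.
by rewrite -eI cardsU1 xI ltnn.
Qed.

Lemma mclosureS A B x :
  A \subset B -> x \in mclosure M A -> x \in mclosure M B.
Proof.
move=> AB; rewrite !inE => /eqP e; rewrite eqn_leq (mrankS M (subsetUr [set x] B)) andbT.
have := mrank_submod M (x |: A) B; rewrite e -setUA (setUidPr AB).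
have := mrankS M (_ : A \subset (x |: A) :&: B); rewrite subsetI subsetUr AB.
by move=> /(_ isT); rlia.
Qed.

(** Makes the hyperplane condition in the definition of the extended lift applicable to every
    circuit. By duality, adding some [x] of [C] to the complement raises the dual rank because
    [C :\ x] is independent. *)
Lemma circuit_hyperplane C :
  C \in circuits M -> ~: C \in hyperplanes (dual M).
Proof.
move=> cC; rewrite inE; have e1 := dual_rank M (~: C); rewrite setCK in e1.
have e2 := dual_rank M setT; rewrite setCT in e2.
have e0 := mrank0.
have e3 := circuit_rank cC; have e4 := cardsC C; rewrite cardsT in e2.
have rC : (mrank (dual M) (~: C)).+1 = mrank (dual M) setT.
  by move: e0 e1 e2 e3 e4; rlia.
rewrite rC eqxx andbT eqEsubset; apply/andP; split; last first.
  by apply/subsetP=> x xC; rewrite inE (setUidPr _) ?sub1set.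
apply/subsetP=> x; rewrite inE => /eqP ex; rewrite inE; apply/negP => xC.
have := dual_rank M (x |: ~: C); rewrite ex cardsU1 inE xC /=.
have -> : ~: (x |: ~: C) = C :\ x by rewrite setCU setCK setIC -setDE.
have := circuitD1_indep cC xC; rewrite indep_rank => /eqP->.
by have := cardsD1 x C; rewrite xC; move: e0 e1 e2 e3 e4 rC; rlia.
Qed.

End Nullity.

(** * Active elements and unidependent sets in terms of circuits and nullity *)

Section Active.
Variables (n : nat) (M : matroid 'I_n) (L : linear_class M).
Implicit Types (A C D I U X : {set 'I_n}) (x y : 'I_n).

Lemma linear_class_circuit C : C \in lc_set L -> C \in circuits M.
Proof. by case: (lcP L) => /subsetP + _; apply. Qed.

Lemma is_min_inj X x y : is_min x X -> is_min y X -> x = y.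
Proof.
case/andP=> xX /forall_inP hx /andP[yX /forall_inP hy].
by apply/val_inj/eqP; rewrite eqn_leq hx ?hy.
Qed.

Lemma is_min_exists X x : x \in X -> exists y, is_min y X.
Proof.
move=> xX; case: (@arg_minnP _ x [in X] (fun i : 'I_n => i : nat) xX) => y yX hy.
by exists y; rewrite /is_min yX; apply/forall_inP.
Qed.

Lemma circuit_min C : C \in circuits M -> exists x, is_min x C.
Proof. by case/circuit_nonempty=> x; apply: is_min_exists. Qed.

Lemma is_min_mem X x : is_min x X -> x \in X.
Proof. by case/andP. Qed.

Lemma is_min_le X x y : is_min x X -> y \in X -> x <= y.
Proof. by case/andP=> _ /forall_inP; apply. Qed.

(** [circuit_in] picks some circuit; nullity at most one forces the choice. *)
Lemma circuit_inE A C : #|A| <= (mrank M A).+1 -> C \in circuits M ->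
  C \subset A -> circuit_in M A = C.
Proof.
move=> hA cC CA; rewrite /circuit_in; case: pickP => [D /andP[cD DA]|/(_ C)] /=.
  exact: circuit_unique hA cD cC DA CA.
by rewrite cC CA.
Qed.

(** Deleting an element of the only circuit leaves an independent set, so the nullity is at most
    one. *)
Lemma circuit_in_unique A C : C \in circuits M -> C \subset A ->
  (forall D, D \in circuits M -> D \subset A -> D = C) -> #|A| <= (mrank M A).+1.
Proof.
move=> cC CA h; have [x xC] := circuit_nonempty cC.
have : A :\ x \in indep M.
  apply: contraT => /dep_circuit[D cD DA].
  have eD := h D cD (subset_trans DA (subsetDl _ _)).
  by have := subsetP DA x; rewrite eD => /(_ xC); rewrite !inE eqxx.
rewrite indep_rank => /eqP; have := mrankS M (subsetDl A [set x]).
by have := cardsD1 x A; rewrite (subsetP CA x xC); rlia.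
Qed.

Lemma unidependentP U : reflect
  (exists C, [/\ C \in lc_set L, 1 < #|C|, C \subset U & #|U| <= (mrank M U).+1])
  (unidependent M L U).
Proof.
apply: (iffP and3P) => [[/cards1P[C eC] CL C1]|[C [CL C1 CU hU]]].
  have : C \in [set C in circuits M | C \subset U] by rewrite eC set11.
  rewrite inE => /andP[cC CU].
  have hU : #|U| <= (mrank M U).+1.
    apply: (circuit_in_unique cC CU) => D cD DU; apply/set1P.
    by rewrite -eC inE cD.
  by rewrite (circuit_inE hU cC CU) in CL C1; exists C.
have cC := linear_class_circuit CL.
rewrite (circuit_inE hU cC CU); split=> //; apply/cards1P; exists C.
apply/setP=> D; rewrite inE in_set1; apply/andP/eqP => [[cD DU]|->] //.
exact: circuit_unique hU cD cC DU CU.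
Qed.

(** One circuit carries all the conditions: its dependence puts [x] outside [I] and in the closure
    of [I], and its size says that [x] is not a loop. *)
Lemma activesP I x : I \in indep M -> reflect
  (exists C, [/\ C \in lc_set L, 1 < #|C|, C \subset x |: I & is_min x C])
  (x \in actives M L I).
Proof.
move=> II; have hU := indepU1_rank x II; rewrite inE.
apply: (iffP and4P) => [[xI /setDP[xcl xnI] CL mx]|[C [CL C1 CU mx]]].
  have [C cC CU] : exists2 C, C \in circuits M & C \subset x |: I.
    apply: dep_circuit; rewrite indep_rank cardsU1 xnI.
    move: xcl; rewrite inE => /eqP->; move: II; rewrite indep_rank => /eqP->.
    by rewrite neq_ltn leqnn.
  rewrite (circuit_inE hU cC CU) in CL mx; exists C; split=> //.
  rewrite ltnNge; apply/negP => C1; case/circuitP: cC => /negP[].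
  have /eqP <- : [set x] == C by rewrite eqEcard sub1set (is_min_mem mx) cards1.
  exact: xI.
have cC := linear_class_circuit CL; have xC := is_min_mem mx.
rewrite (circuit_inE hU cC CU); split=> //; first exact: set1_circuit xC C1.
have xnI : x \notin I.
  apply: contraL II => xI; apply: (circuit_dep cC); apply: subset_trans CU _.
  by rewrite subUset sub1set xI subxx.
rewrite in_setD xnI inE eqn_leq (mrankS M (subsetUr [set x] I)) andbT.
have := dep_rank (circuit_dep cC CU); rewrite cardsU1 xnI.
by move: II; rewrite indep_rank => /eqP->.
Qed.

Lemma unidependent_indepD1 U C x : C \in circuits M -> C \subset U ->
  #|U| <= (mrank M U).+1 -> x \in C -> U :\ x \in indep M.
Proof.
move=> cC CU hU xC; apply: contraT => /dep_circuit[D cD DU].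
have eD := circuit_unique hU cD cC (subset_trans DU (subsetDl _ _)) CU.
by have := subsetP DU x; rewrite eD => /(_ xC); rewrite !inE eqxx.
Qed.

(** Hence [U] can fail to be inactive only through a smaller active element. *)
Lemma unidependent_active U C x : C \in lc_set L -> 1 < #|C| -> C \subset U ->
  #|U| <= (mrank M U).+1 -> is_min x C -> x \in actives M L (U :\ x).
Proof.
move=> CL C1 CU hU mx; have cC := linear_class_circuit CL; have xC := is_min_mem mx.
apply/activesP; first exact: unidependent_indepD1 cC CU hU xC.
by exists C; rewrite setD1K ?(subsetP CU).
Qed.

Lemma inactiveP U C x : C \in circuits M -> C \subset U ->
  #|U| <= (mrank M U).+1 -> is_min x C ->
  inactive M L U = is_min x (actives M L (U :\ x)).
Proof.
move=> cC CU hU mx; rewrite /inactive (circuit_inE hU cC CU).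
apply/existsP/idP => [[y /andP[my]]|h]; first by rewrite (is_min_inj my mx).
by exists x; rewrite mx.
Qed.

Lemma NBC_indep I : I \in NBC M L -> I \in indep M.
Proof. by rewrite inE => /andP[]. Qed.

(** For [x] the minimum of [C], the broken circuit [C :\ x] lies in [I] exactly when [C] lies in
    [x |: I]. *)
Lemma NBC_actives I : I \in indep M -> (I \in NBC M L) = (actives M L I == set0).
Proof.
move=> II; rewrite inE II /=; apply/forallP/eqP => [h|h B].
  apply/eqP; apply: contraT => /set0Pn[x /(activesP _ II)[C [CL C1 CU mx]]].
  have /implyP/(_ _)/negP := h (C :\ x); case.
    by apply/exists_inP; exists C; rewrite ?C1 //; apply/existsP; exists x; rewrite mx eqxx.
  apply/subsetP=> y; rewrite !inE => /andP[yx yC].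
  by have := subsetP CU y yC; rewrite !inE (negPf yx).
apply/implyP=> /exists_inP[C CL /andP[C1 /existsP[x /andP[mx /eqP->]]]].
apply/negP => CI; suff : x \in actives M L I by rewrite h inE.
apply/(activesP _ II); exists C; split=> //.
by rewrite -(setD1K (is_min_mem mx)) setUS.
Qed.

End Active.

(** * The rank function of the extended lift *)

Section Widen.
Variable n : nat.
Implicit Types (A B : {set 'I_n}) (X : {set 'I_n.+1}) (i : 'I_n).
Local Notation w := (widen_ord (leqnSn n)).

Lemma widen_ord_max i : w i != ord_max.
Proof. by rewrite -val_eqE /= neq_ltn ltn_ord. Qed.

Lemma widen_inj : injective w.
Proof. by move=> i j /(congr1 val) /= /val_inj. Qed.

Lemma mem_widen i A : (w i \in widen_set A) = (i \in A).
Proof. by rewrite mem_imset //; apply: widen_inj. Qed.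

Lemma max_widen A : ord_max \in widen_set A = false.
Proof. by apply/imsetP=> -[i _ /esym/eqP]; rewrite (negPf (widen_ord_max i)). Qed.

Lemma ordSP (x : 'I_n.+1) : x = ord_max \/ exists i, x = w i.
Proof.
have [lt|ge] := ltnP x n; [right | left].
  by exists (Ordinal lt); apply: val_inj.
by apply: val_inj; apply/eqP; rewrite eqn_leq ge -ltnS ltn_ord.
Qed.

Lemma widen_set_inj : injective (@widen_set n).
Proof. by apply: imset_inj; apply: widen_inj. Qed.

Lemma card_widen A : #|widen_set A| = #|A|.
Proof. by rewrite card_imset //; apply: widen_inj. Qed.

Lemma widen_setU1 i A : widen_set (i |: A) = w i |: widen_set A.
Proof. by rewrite /widen_set imsetU1. Qed.

Lemma widen_setD1 i A : widen_set (A :\ i) = widen_set A :\ w i.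
Proof.
apply/setP=> x; have [->|[j ->]] := ordSP x.
  by rewrite in_setD1 !max_widen andbF.
by rewrite in_setD1 !mem_widen in_setD1 (inj_eq widen_inj).
Qed.

Lemma widen_set_sub X : ord_max \notin X -> exists A, X = widen_set A.
Proof.
move=> mX; exists [set i | w i \in X]; apply/setP=> x.
have [->|[j ->]] := ordSP x; first by rewrite max_widen (negPf mX).
by rewrite mem_widen inE.
Qed.

Lemma widen_setP X : (exists A, X = widen_set A) \/ (exists A, X = ord_max |: widen_set A).
Proof.
have [mX|/widen_set_sub] := boolP (ord_max \in X); last by left.
have [|A eA] := @widen_set_sub (X :\ ord_max); first by rewrite setD11.
by right; exists A; rewrite -eA setD1K.
Qed.

Lemma setC_widen A : ~: widen_set A = ord_max |: widen_set (~: A).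
Proof.
apply/setP=> x; have [->|[j ->]] := ordSP x; first by rewrite in_setC setU11 max_widen.
by rewrite in_setC in_setU1 !mem_widen in_setC (negPf (widen_ord_max j)).
Qed.

Lemma setT_widen : setT = ord_max |: widen_set [set: 'I_n].
Proof. by rewrite -[[set: 'I_n]]setC0 -setC_widen /widen_set imset0 setC0. Qed.

Lemma widen_setS A B : A \subset B -> widen_set A \subset widen_set B.
Proof. exact: imsetS. Qed.

End Widen.

Section LiftRank.
Variables (n : nat) (M : matroid 'I_n) (L : linear_class M).
Implicit Types (A B C D : {set 'I_n}) (X : {set 'I_n.+1}).
Local Notation N := (extended_lift L).

(** These turn out to be the sets whose rank the lift leaves unchanged. *)
Definition balanced A := [forall C in circuits M, (C \subset A) ==> (C \in lc_set L)].

Lemma balancedP A : reflect (forall C, C \in circuits M -> C \subset A -> C \in lc_set L)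
  (balanced A).
Proof.
apply: (iffP forall_inP) => h C cC; first exact/implyP/h.
by apply/implyP; apply: h.
Qed.

Lemma dual_lift_indep A : (widen_set A \in indep (dual N)) = (A \in indep (dual M)).
Proof. by case/and3P: (extended_liftP L) => /forallP/(_ A)/eqP. Qed.

Lemma dual_lift_max : ord_max \in mclosure (dual N) (widen_set setT).
Proof. by case/and3P: (extended_liftP L). Qed.

Lemma dual_lift_hyperplane H : H \in hyperplanes (dual M) ->
  (ord_max \in mclosure (dual N) (widen_set H)) = (~: H \in lc_set L).
Proof. by case/and3P: (extended_liftP L) => _ _ /forall_inP/(_ H) h /h/eqP. Qed.

(** [dual M] is the restriction of [dual N] to the old elements. *)
Lemma dual_lift_rank A : mrank (dual N) (widen_set A) = mrank (dual M) A.
Proof.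
apply/eqP; rewrite eqn_leq; apply/andP; split.
  have [I [II IA <-]] := rank_basis (dual N) (widen_set A).
  have [|B eB] := @widen_set_sub _ I.
    by apply/negP=> /(subsetP IA); rewrite max_widen.
  rewrite eB card_widen; rewrite eB dual_lift_indep in II; apply: mrank_ge II _.
  by apply/subsetP=> i iB; rewrite -mem_widen (subsetP IA) // eB mem_widen.
have [I [II IA <-]] := rank_basis (dual M) A.
by rewrite -card_widen mrank_ge ?dual_lift_indep // widen_setS.
Qed.

(** The definition prescribes the modular cut on hyperplanes only; this extends it to all sets. A
    circuit avoiding [A] is the complement of a hyperplane above [A], and closure is monotone.
    Conversely, a maximal [H] above [A] whose closure misses [ord_max] is shown to be a hyperplane,
    and its complement is then a circuit avoiding [A]. *)
Lemma dual_lift_closure A :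
  (ord_max \in mclosure (dual N) (widen_set A)) = balanced (~: A).
Proof.
apply/idP/balancedP => [mA C cC CA|bA].
  rewrite -(setCK C) -dual_lift_hyperplane ?circuit_hyperplane //.
  by apply: mclosureS mA; rewrite widen_setS // -(setCK A) setCS.
apply: contraT => mA.
pose P := [pred B : {set 'I_n} | ord_max \notin mclosure (dual N) (widen_set B)].
have [H /maxsetP[/= mH Hmax] AH] : exists2 H, maxset P H & A \subset H.
  by have [H] := @maxset_exists _ P A mA; exists H.
have rH : mrank (dual N) (ord_max |: widen_set H) = (mrank (dual M) H).+1.
  move: mH; rewrite inE -dual_lift_rank.
  have := mrankS (dual N) (subsetUr [set ord_max] (widen_set H)).
  by have := mrank1 (dual N) ord_max (widen_set H); rlia.
have hH x : x \notin H ->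
    mrank (dual N) (ord_max |: widen_set (x |: H)) = mrank (dual M) (x |: H).
  move=> xH; have : ord_max \in mclosure (dual N) (widen_set (x |: H)).
    apply: contraT => nm; have := Hmax _ nm (subsetUr _ _) => eH.
    by case/negP: xH; rewrite -eH setU11.
  by rewrite inE dual_lift_rank => /eqP.
(* By maximality of [H], [ord_max] lies in the closure of [x |: H], whose rank is therefore at least
   that of [H] with [ord_max]. *)
have rxH x : x \notin H -> mrank (dual M) (x |: H) = (mrank (dual M) H).+1.
  move=> /hH; have := mrank1 (dual M) x H.
  have : ord_max |: widen_set H \subset ord_max |: widen_set (x |: H).
    by rewrite setUS // widen_setS ?subsetUr.
  by move/(mrankS (dual N)); rewrite rH; rlia.
(* [H] together with [ord_max] spans: no further element raises its rank. *)
have rT : mrank (dual N) setT = (mrank (dual M) H).+1.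
  rewrite -rH; apply/esym/mclosure_setT => x; rewrite inE.
  have [->|[i ->]] := ordSP x; first by rewrite setUA setUid.
  rewrite setUCA -widen_setU1 rH; have [iH|iH] := boolP (i \in H).
    by have /setUidPr-> : [set i] \subset H; rewrite ?sub1set ?rH.
  by rewrite hH // rxH.
(* Here it matters that [ord_max] is not a coloop of [dual N]: the two duals have the same rank. *)
have rTM : mrank (dual M) setT = mrank (dual N) setT.
  rewrite -dual_lift_rank setT_widen; apply/esym/eqP.
  by have := dual_lift_max; rewrite inE.
have hyp : H \in hyperplanes (dual M).
  rewrite inE rTM rT eqxx andbT eqEsubset; apply/andP; split; apply/subsetP=> x.
    rewrite inE; apply: contraTT => /rxH->; by rewrite neq_ltn ltnSn orbT.
  by move=> xH; rewrite inE (setUidPr _) ?sub1set.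
suff cH : ~: H \in circuits M.
  by rewrite -(negPf mH) dual_lift_hyperplane // bA // setCS.
have e1 := dual_rank M H; have e2 := dual_rank M setT; rewrite setCT cardsT in e2.
have e0 := mrank0 M.
have e3 := cardsC H; rewrite rTM rT in e2.
have [C cC CH] : exists2 C, C \in circuits M & C \subset ~: H.
  by apply: dep_circuit; rewrite indep_rank; apply/eqP; move: e0 e1 e2 e3; rlia.
suff -> : ~: H = C by [].
(* If [C] missed some [x] outside [H], it would lie in the complement of the spanning set [x |: H],
   which is independent in [M]. *)
apply/eqP; rewrite eqEsubset CH andbT; apply/subsetP=> x; rewrite inE => xH.
apply: contraT => xC.
have CxH : C \subset ~: (x |: H).
  by rewrite setCU subsetI CH andbT -setCS setCK sub1set inE.
case/negP: (circuit_dep cC CxH); rewrite indep_rank.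
have := dual_rank M (x |: H); rewrite rxH // cardsU1 xH /=.
have := cardsC (x |: H); rewrite cardsU1 xH /= => h1 h2.
by apply/eqP; move: e0 e1 e2 e3 h1 h2; rlia.
Qed.

(** The dual gains an element but no rank. *)
Lemma lift_rankT : mrank N setT = (mrank M setT).+1.
Proof.
have := dual_rank N setT; have := dual_rank M setT; rewrite !setCT !cardsT !card_ord.
rewrite !mrank0 -(dual_lift_rank setT) [in X in _ -> X -> _]setT_widen.
have := dual_lift_max; rewrite inE => /eqP ->.
by rewrite -setT_widen; rlia.
Qed.

Lemma lift_rank_max A : mrank N (ord_max |: widen_set A) = (mrank M A).+1.
Proof.
rewrite -{1}(setCK A) -setC_widen; have := dual_rank N (widen_set (~: A)).
have := dual_rank M (~: A); rewrite setCK dual_lift_rank lift_rankT card_widen.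
by rlia.
Qed.

(** The complement of [widen_set A] contains [ord_max]. Its dual rank exceeds that of the part in
    [M] unless [ord_max] is in the closure of that part, that is, unless [A] is balanced. *)
Lemma lift_rank A : mrank N (widen_set A) = mrank M A + ~~ balanced A.
Proof.
have := dual_rank N (ord_max |: widen_set (~: A)); have := dual_rank M (~: A).
rewrite -setC_widen !setCK setC_widen lift_rankT cardsU1 max_widen card_widen /=.
have := dual_lift_closure (~: A); rewrite setCK inE dual_lift_rank.
have := mrank1 (dual N) ord_max (widen_set (~: A)).
have := mrankS (dual N) (subsetUr [set ord_max] (widen_set (~: A))).
by rewrite dual_lift_rank; case: (balanced A) => /=; rlia.
Qed.

End LiftRank.

Import GRing.Theory.
Local Open Scope ring_scope.

(** * Boundary and ideals in the exterior algebra *)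

Section SpanMul.
Variables (K : fieldType) (A : falgType K).

Lemma span_mull (s : seq A) (a : A) (W : {vspace A}) :
  {in s, forall g, a * g \in W} -> {in <<s>>%VS, forall v, a * v \in W}.
Proof.
move=> h v vs; have : amull a v \in (amull a @: <<s>>)%VS by apply: memv_img.
rewrite lfunE /= limg_span; apply/subvP/span_subvP => _ /mapP[g gs ->].
by rewrite lfunE /= h.
Qed.

Lemma span_mulr (s : seq A) (a : A) (W : {vspace A}) :
  {in s, forall g, g * a \in W} -> {in <<s>>%VS, forall v, v * a \in W}.
Proof.
move=> h v vs; have : amulr a v \in (amulr a @: <<s>>)%VS by apply: memv_img.
rewrite lfunE /= limg_span; apply/subvP/span_subvP => _ /mapP[g gs ->].
by rewrite lfunE /= h.
Qed.

Lemma mem_lpreim (U W : vectType K) (f : {linear U -> W}) (V : {vspace W}) x :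
  (x \in linfun f @^-1: V)%VS = (f x \in V).
Proof. by rewrite -memv_preim lfunE. Qed.

End SpanMul.

Section ExteriorCalculus.
Variables (K : fieldType) (n : nat).
Local Notation E := (ext K n).
Local Notation e := (@ext_e K n).
Implicit Types (A B C U X : {set 'I_n}) (x y z : E) (i j : 'I_n) (V : {vspace E}).

(** The exponent of the sign that moves the generator of [i] to its place among those of [X]. Unlike
    the exponent in [ext_d], it does not count [i] itself. *)
Definition below i X : nat := (\sum_(j in X) (j < i))%N.

Lemma below_card i X : i \in X -> #|[set j in X | (j <= i)%N]| = (below i X).+1.
Proof.
move=> iX; rewrite -sum1dep_card big_mkcondr /below !(big_setD1 i iX) /=.
rewrite leqnn ltnn add0n add1n; congr _.+1; apply: eq_bigr => j.
rewrite !inE => /andP[ji _].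
by rewrite leq_eqVlt (negPf ji : (j == i :> nat) = false); case: ltngtP.
Qed.

Lemma belowD1 i j X : j \in X -> below i X = ((j < i) + below i (X :\ j))%N.
Proof. by move=> jX; rewrite /below (big_setD1 j jX). Qed.

Lemma belowU1 i j X : j \notin X -> below i (j |: X) = ((j < i) + below i X)%N.
Proof. by move=> jX; rewrite /below big_setU1. Qed.

Lemma ext_mul_in i X : i \in X -> e [set i] * e X = 0.
Proof. by move=> iX; rewrite ext_mulE /shuffle_sign disjoints1 iX scale0r. Qed.

Lemma ext_mul_notin i X : i \notin X ->
  e [set i] * e X = (-1) ^+ below i X *: e (i |: X).
Proof.
by move=> iX; rewrite ext_mulE /shuffle_sign disjoints1 iX /inversions big_set1.
Qed.

Lemma signrK (m : nat) x : (-1 : K) ^+ m *: ((-1) ^+ m *: x) = x.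
Proof. by rewrite scalerA -exprD addnn -mul2n exprM sqrrN expr1n expr1n scale1r. Qed.

Lemma ext_eU1 i X : i \notin X -> e (i |: X) = (-1) ^+ below i X *: (e [set i] * e X).
Proof. by move=> iX; rewrite ext_mul_notin // signrK. Qed.

Lemma ext_eD1 i X : i \in X -> e X = (-1) ^+ below i X *: (e [set i] * e (X :\ i)).
Proof.
by move=> iX; rewrite -{1}(setD1K iX) ext_eU1 ?setD11 // (belowD1 i iX) ltnn.
Qed.

Lemma ext_mulC i X : e X * e [set i] = (-1) ^+ #|X| *: (e [set i] * e X).
Proof.
have [iX|iX] := boolP (i \in X).
  rewrite (ext_mul_in iX) scaler0 ext_mulE /shuffle_sign disjoint_sym disjoints1 iX.
  by rewrite scale0r.
rewrite (ext_mul_notin iX) ext_mulE /shuffle_sign disjoint_sym disjoints1 iX /=.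
rewrite setUC scalerA; congr (_ *: _).
rewrite -exprD -signr_odd -[RHS]signr_odd; congr (_ ^+ nat_of_bool _).
(* Each element of [X] is above or below [i], so the two exponents have the same parity. *)
have -> : #|X| = (inversions X [set i] + below i X)%N.
  rewrite -sum1_card /inversions /below -big_split /=; apply: eq_bigr => j jX.
  rewrite big_set1; have : i != j by apply: contraNneq iX => ->.
  by rewrite -val_eqE /=; case: ltngtP.
by rewrite -addnA addnn oddD odd_double addbF.
Qed.

Lemma ext_dE X : ext_d (e X) = - \sum_(i in X) (-1) ^+ below i X *: e (X :\ i).
Proof.
rewrite ext_d_e -sumrN; apply: eq_bigr => i iX.
by rewrite below_card // exprS mulN1r scaleNr.
Qed.

(** Every term of the boundary has degree one less than [X]. Together with [ext_mulC], this lets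
    right multiplication be reduced to left multiplication. *)
Lemma ext_d_mulC i X :
  ext_d (e X) * e [set i] = (-1) ^+ #|X|.-1 *: (e [set i] * ext_d (e X)).
Proof.
rewrite ext_dE mulNr mulrN scalerN; congr (- _).
rewrite mulr_suml mulr_sumr scaler_sumr; apply: eq_bigr => j jX.
rewrite -scalerAl -scalerAr ext_mulC !scalerA mulrC.
by rewrite (cardsD1 j X) jX.
Qed.

(** The antiderivation rule; counting positions from 1 makes the boundary of a generator equal to
    -1, whence the overall minus sign. *)
Lemma ext_d_mul_e i X :
  ext_d (e [set i] * e X) = - (e X + e [set i] * ext_d (e X)).
Proof.
rewrite (ext_dE X) mulrN mulr_sumr.
have [iX|iX] := boolP (i \in X).
  rewrite ext_mul_in // linear0 (big_setD1 i iX) /= big1 => [|j].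
    by rewrite addr0 -scalerAr -ext_eD1 // subrr oppr0.
  rewrite !inE => /andP[ji jX]; rewrite -scalerAr ext_mul_in ?scaler0 //.
  by rewrite !inE eq_sym ji.
rewrite ext_mul_notin // linearZ /= ext_dE scalerN big_setU1 //=.
rewrite belowU1 // ltnn add0n setU1K // scalerDr signrK; congr (- (_ + _)).
rewrite scaler_sumr -sumrN; apply: eq_bigr => j jX.
have ij : i != j by apply: contraNneq iX => ->.
have -> : (i |: X) :\ j = i |: X :\ j.
  by apply/setP=> k; rewrite !inE; have [->|] := eqVneq k i; rewrite ?ij ?orbF.
rewrite -scalerAr ext_mul_notin ?inE ?(negPf iX) ?andbF //.
rewrite !scalerA -scaleNr; congr (_ *: _).
(* Exactly one of [j < i] and [i < j] holds, so exactly one exponent grows by one and the signs are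
   opposite. *)
rewrite (belowU1 j iX) (belowD1 i jX); move: ij; rewrite -val_eqE /=.
by case: ltngtP => //= _ _; rewrite !add0n !add1n exprS mulN1r ?mulNr ?mulrN 1?mulrC ?opprK.
Qed.

Lemma ext_d_mul i y : ext_d (e [set i] * y) = - (y + e [set i] * ext_d y).
Proof.
rewrite {1 3}(ext_expand y) mulr_sumr !linear_sum mulr_sumr {2}(ext_expand y).
rewrite -big_split -sumrN; apply: eq_bigr => X _ /=.
by rewrite -scalerAr !linearZ /= ext_d_mul_e -scalerAr -scalerDr scalerN.
Qed.

Lemma ext_d1 : ext_d (1 : E) = 0.
Proof. by rewrite -ext_e0 ext_dE big_set0 oppr0. Qed.

Lemma set_ind_card (P : {set 'I_n} -> Prop) :
  P set0 -> (forall i X, i \notin X -> P X -> P (i |: X)) -> forall X, P X.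
Proof.
move=> P0 PU X; have [m] := ubnP #|X|; elim: m X => // m IHm X.
have [->//|[i iX]] := set_0Vmem X; rewrite (cardsD1 i) iX add1n ltnS => lt.
by rewrite -(setD1K iX); apply: PU; [rewrite setD11 | apply: IHm].
Qed.

Lemma ext_dd_e X : ext_d (ext_d (e X)) = 0.
Proof.
elim/set_ind_card: X => [|i X iX IH]; first by rewrite ext_e0 ext_d1 linear0.
rewrite ext_eU1 // !linearZ /= ext_d_mul linearN linearD /= ext_d_mul IH.
by rewrite mulr0 addr0 subrr oppr0 scaler0.
Qed.

Lemma ext_ideal_mull V : (forall i v, v \in V -> e [set i] * v \in V) ->
  forall x v, v \in V -> x * v \in V.
Proof.
move=> h x v vV; rewrite (ext_expand x) mulr_suml; apply: memv_suml => X _.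
rewrite -scalerAl memvZ //; elim/set_ind_card: X => [|i X iX IH].
  by rewrite ext_e0 mul1r.
by rewrite ext_eU1 // -scalerAl memvZ // -mulrA h.
Qed.

Lemma ext_ideal_mulr V : (forall i v, v \in V -> v * e [set i] \in V) ->
  forall v x, v \in V -> v * x \in V.
Proof.
move=> h v x vV; rewrite (ext_expand x) mulr_sumr; apply: memv_suml => X _.
rewrite -scalerAr memvZ //; elim/set_ind_card: X v vV => [|i X iX IH] v vV.
  by rewrite ext_e0 mulr1.
by rewrite ext_eU1 // -scalerAr memvZ // mulrA IH ?h.
Qed.

(** The boundary of [e (i |: X)] contains [e X] up to sign, and can be solved for it. *)
Lemma ext_e_exchange V i X : i \notin X -> ext_d (e (i |: X)) \in V ->
  (forall j, j \in X -> e ((i |: X) :\ j) \in V) -> e X \in V.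
Proof.
move=> iX dV h; rewrite -(signrK (below i (i |: X)) (e X)) memvZ //.
move: dV.
rewrite ext_dE memvN big_setU1 //= setU1K // => /memvB.
move=> /(_ (\sum_(j in X) (-1) ^+ below j (i |: X) *: e ((i |: X) :\ j))).
by rewrite addrK; apply; apply: memv_suml => j jX; rewrite memvZ ?h.
Qed.

(** The same solving, now in the relation that the boundary of the boundary of [e (i |: U)]
    vanishes. *)
Lemma ext_d_exchange V i U : i \notin U ->
  (forall j, j \in U -> ext_d (e ((i |: U) :\ j)) \in V) -> ext_d (e U) \in V.
Proof.
move=> iU h; rewrite -(signrK (below i (i |: U)) (ext_d (e U))) memvZ //.
have := ext_dd_e (i |: U).
rewrite (ext_dE (i |: U)) big_setU1 //= setU1K // linearN linearD linearZ /=.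
move=> /eqP; rewrite oppr_eq0 addr_eq0 => /eqP->; rewrite memvN linear_sum.
by apply: memv_suml => j jU; rewrite linearZ /= memvZ ?h.
Qed.

Section LeftIdeal.
Variable V : {vspace E}.
Hypothesis Vmul : forall x v, v \in V -> x * v \in V.

Lemma ideal_ext_e C X : e C \in V -> e (X :|: C) \in V.
Proof.
move=> CV; elim/set_ind_card: X => [|i X iX IH]; first by rewrite set0U.
rewrite -setUA; have [iXC|iXC] := boolP (i \in X :|: C).
  by rewrite (setUidPr _) ?sub1set.
by rewrite ext_eU1 // memvZ // Vmul.
Qed.

(** By the antiderivation rule, adjoining a generator brings in both the monomial and its boundary,
    so both are carried along. *)
Lemma ideal_ext_d C X : e C \in V -> ext_d (e C) \in V -> ext_d (e (X :|: C)) \in V.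
Proof.
move=> CV dCV; elim/set_ind_card: X => [|i X iX IH]; first by rewrite set0U.
rewrite -setUA; have [iXC|iXC] := boolP (i \in X :|: C).
  by rewrite (setUidPr _) ?sub1set.
rewrite ext_eU1 // linearZ /= memvZ // ext_d_mul memvN memvD ?Vmul //.
exact: ideal_ext_e.
Qed.

End LeftIdeal.

End ExteriorCalculus.

(** * The ideal and its basis *)

Section BiasIdeal.
Variables (n : nat) (K : fieldType) (M : matroid 'I_n) (L : linear_class M).
Local Notation e := (@ext_e K n).
Implicit Types (A B C D I J U X : {set 'I_n}) (i j x y : 'I_n).

Local Notation S := <<Im_basis M L K>>%VS.

Lemma dep_mem D : D \notin indep M -> e D \in S.
Proof.
move=> dD; apply: memv_span; rewrite mem_cat; apply/orP; right.
by apply: image_f; rewrite inE.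
Qed.

Lemma nullity2_d_mem U : ((mrank M U).+1 < #|U|)%N -> ext_d (e U) \in S.
Proof.
move=> hU; rewrite ext_dE memvN; apply: memv_suml => i iU.
by rewrite memvZ // dep_mem // nullity2_dep.
Qed.

Lemma two_circuits_d_mem U C D : C \in circuits M -> D \in circuits M ->
  C \subset U -> D \subset U -> C != D -> ext_d (e U) \in S.
Proof.
move=> cC cD CU DU neq; apply: nullity2_d_mem; rewrite ltnNge.
by apply: contra neq => hU; apply/eqP; apply: circuit_unique hU cC cD CU DU.
Qed.

(** The measure of both inductions: exchanging an element for a smaller one lowers it. *)
Definition weight X : nat := (\sum_(i in X) i)%N.

Lemma weight_exchange i j X : i \in X -> j \notin X -> (j < i)%N ->
  (weight ((j |: X) :\ i) < weight X)%N.
Proof.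
move=> iX jX ji; have ij : i != j by apply: contraNneq jX => <-.
have -> : (j |: X) :\ i = j |: X :\ i.
  by apply/setP=> k; rewrite !inE; have [->|] := eqVneq k j; rewrite // eq_sym ij.
by rewrite /weight big_setU1 ?(big_setD1 i iX) /= ?ltn_add2r // !inE (negPf jX) andbF.
Qed.

Lemma ext_d_mem C U : C \in lc_set L -> (1 < #|C|)%N -> C \subset U ->
  ext_d (e U) \in S.
Proof.
have [m] := ubnP (weight U); elim: m => // m IHm in C U *; rewrite ltnS => le_m.
move=> CL C1 CU; have cC := linear_class_circuit CL.
have [hU|hU] := leqP #|U| (mrank M U).+1; last exact: nullity2_d_mem.
have [a ma] := circuit_min cC.
have aC := is_min_mem ma; have aU := subsetP CU a aC.
have II := unidependent_indepD1 cC CU hU aC.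
have aact := unidependent_active CL C1 CU hU ma.
have [iU|] := boolP (inactive M L U).
  apply: memv_span; rewrite mem_cat; apply/orP; left; apply: image_f.
  by rewrite inE iU andbT; apply/unidependentP; exists C.
rewrite (inactiveP L cC CU hU ma) => nact.
have [b mb] := is_min_exists aact.
have ba : (b < a)%N.
  rewrite ltn_neqAle (is_min_le mb aact) andbT.
  by apply: contraNneq nact => /val_inj eba; rewrite -{1}eba.
have /(activesP L _ II)[D [DL D1 DU mD]] := is_min_mem mb.
have cD := linear_class_circuit DL; have bD := is_min_mem mD.
have bU : b \notin U.
  apply: contra (circuit_dep cD DU) => bU; apply: indepS II _.
  rewrite subUset sub1set subxx andbT !inE bU andbT.
  by apply: contraTneq ba => ->; rewrite ltnn.
have DbU : D \subset b |: U by apply: subset_trans DU (setUS _ (subsetDl _ _)).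
have CbU : C \subset b |: U by apply: subset_trans CU (subsetUr _ _).
have CD : C != D by apply: contraNneq bU => eCD; rewrite (subsetP CU) // eCD.
have IbU : U :\ a \subset b |: U by rewrite (subset_trans (subsetDl _ _)) ?subsetUr.
(* [b |: U] contains two circuits, so its nullity is at least two and [U :\ a] is a basis of it. *)
have rI : #|U :\ a| = mrank M (b |: U).
  apply/eqP; rewrite eqn_leq mrank_ge //=.
  have : ~~ (#|b |: U| <= (mrank M (b |: U)).+1)%N.
    by apply: contra CD => h; apply/eqP; apply: circuit_unique h cC cD CbU DbU.
  by rewrite cardsU1 bU (cardsD1 a U) aU; rlia.
(* The minima of [C] and [D] are at least [b], so removing some [y < b] leaves both circuits in
   place. *)
apply: (ext_d_exchange bU) => y yU; have [yb|by_] := ltnP y b.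
  have nC X x : is_min x X -> (b <= x)%N -> X \subset b |: U -> X \subset (b |: U) :\ y.
    move=> mX bx XbU; rewrite subsetD1 XbU /=; apply: contraL yb => /(is_min_le mX).
    by rewrite -leqNgt; apply: leq_trans.
  apply: (two_circuits_d_mem cC cD) => //; first by apply: nC ma (ltnW ba) CbU.
  exact: nC mD (leqnn b) DbU.
have {by_}yb : (b < y)%N.
  by rewrite ltn_neqAle by_ andbT; apply: contraNneq bU => /val_inj ->.
have [F cF FU] : exists2 F, F \in circuits M & F \subset (b |: U) :\ y.
  apply: dep_circuit; rewrite indep_rank; have := mrankS M (subsetDl (b |: U) [set y]).
  rewrite -rI; have := cardsD1 y (b |: U); rewrite cardsU1 bU !inE yU orbT.
  by rewrite (cardsD1 a U) aU => h1 h2; rewrite neq_ltn; apply/orP; left; move: h1 h2; rlia.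
have FbU := subset_trans FU (subsetDl _ _).
(* [C] and [D] are the only fundamental circuits for the basis [U :\ a] of [b |: U]. *)
have Fin x G : x \in b |: U -> G \in circuits M -> G \subset x |: U :\ a ->
    G \in [set C; D].
  move=> xbU cG GU; have [xI|xI] := boolP (x \in U :\ a).
    case/negP: (circuit_dep cG GU).
    by apply: indepS II _; rewrite subUset sub1set xI subxx.
  have : x \in [set a; b].
    by move: xbU xI; rewrite !inE; case: (x == a); case: (x == b) => //= ->.
  rewrite !inE => /orP[] /eqP ex; apply/orP; [left|right]; apply/eqP; move: GU; rewrite ex.
    by move=> GU; apply: (circuit_uniq II cG cC GU); rewrite setD1K.
  by move=> GU; apply: (circuit_uniq II cG cD GU).
apply: (IHm F) => //.
- apply: leq_trans le_m; exact: weight_exchange.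
(* Linearity of the class enters here: it contains both fundamental circuits, hence every circuit
   inside [b |: U]. *)
- apply: (fundamental_balanced II IbU rI _ cF FbU) => x G xbU cG GU.
  by have := Fin x G xbU cG GU; rewrite !inE => /orP[] /eqP->.
(* A loop [F] would be a fundamental circuit, hence [C] or [D], which have more than one element. *)
have [l lF] := circuit_nonempty cF.
rewrite ltnNge; apply/negP => F1.
have eF : F = [set l] by apply/esym/eqP; rewrite eqEcard sub1set lF cards1.
have lbU := subsetP FbU l lF.
have : F \in [set C; D].
  by apply: (Fin l) => //; rewrite eF subsetUl.
by rewrite !inE => /orP[] /eqP eFX; move: F1; rewrite eFX leqNgt ?C1 ?D1.
Qed.

(** * Spanning, counting and the ideal property *)

Local Notation nbc := [seq e J | J : {set 'I_n} in NBC M L].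

Lemma nbc_Im_span X : e X \in <<nbc ++ Im_basis M L K>>%VS.
Proof.
have subS : (S <= <<nbc ++ Im_basis M L K>>)%VS by rewrite (span_cat nbc) addvSr.
have depV D : D \notin indep M -> e D \in <<nbc ++ Im_basis M L K>>%VS.
  by move/dep_mem; apply: (subvP subS).
have [m] := ubnP (weight X); elim: m => // m IHm in X *; rewrite ltnS => le_m.
have [XI|/depV//] := boolP (X \in indep M).
have [XN|] := boolP (X \in NBC M L).
  by apply: memv_span; rewrite mem_cat image_f.
rewrite (NBC_actives L XI) => /set0Pn[x xX].
have [a ma] := is_min_exists xX.
have /(activesP L _ XI)[C [CL C1 CU mC]] := is_min_mem ma.
have cC := linear_class_circuit CL; have aC := is_min_mem mC.
have aX : a \notin X.
  by apply: contra (circuit_dep cC CU) => aX; rewrite (setUidPr _) ?sub1set.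
apply: (ext_e_exchange aX) => [|j jX]; first exact: (subvP subS _ (ext_d_mem CL C1 CU)).
(* Removing [j] outside [C] leaves a dependent set; a [j] in [C] exceeds its minimum [a], so
   exchanging it lowers the weight. *)
have [jC|jC] := boolP (j \in C); last first.
  by apply/depV/(circuit_dep cC); rewrite subsetD1 CU.
apply: IHm; apply: leq_trans le_m; apply: weight_exchange => //.
rewrite ltn_neqAle (is_min_le mC jC) andbT; apply: contraNneq aX.
by move/val_inj ->.
Qed.

Lemma card_inactive :
  (#|[set U | unidependent M L U && inactive M L U]| <= #|indep M :\: NBC M L|)%N.
Proof.
(* The default [U] is never reached on unidependent sets, whose circuit has a minimum. *)
pose f U := if [pick x | is_min x (circuit_in M U)] is Some x then U :\ x else U.
have fE U : unidependent M L U -> inactive M L U ->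
  exists x, [/\ f U = U :\ x, x \in U, U :\ x \in indep M
              & is_min x (actives M L (U :\ x))].
  move=> /unidependentP[C [CL C1 CU hU]]; have cC := linear_class_circuit CL.
  move=> iU; have [a ma] := circuit_min cC.
  exists a; rewrite -(inactiveP L cC CU hU ma) (subsetP CU) ?(is_min_mem ma) //.
  split=> //; last exact: unidependent_indepD1 cC CU hU (is_min_mem ma).
  rewrite /f; case: pickP => [y|/(_ a)]; rewrite (circuit_inE hU cC CU) ?ma //.
  by move/is_min_inj/(_ ma) ->.
rewrite -(card_in_imset (f := f)) => [|U V]; last first.
  rewrite !inE => /andP[uU iU] /andP[uV iV].
  have [x [-> xU _ mx]] := fE U uU iU; have [y [-> yV _ my]] := fE V uV iV.
  (* The deleted element is recovered as the smallest active element of the image. *)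
  move=> eUV; rewrite -eUV in my; have exy := is_min_inj mx my; subst y.
  by rewrite -(setD1K xU) -(setD1K yV) eUV.
apply/subset_leq_card/subsetP => _ /imsetP[U + ->]; rewrite inE => /andP[uU iU].
have [x [-> xU II mx]] := fE U uU iU; rewrite inE II andbT (NBC_actives L II).
by apply/set0Pn; exists x; apply: is_min_mem mx.
Qed.

Lemma dim_ext : \dim {:ext K n} = #|{: {set 'I_n}}|.
Proof. by rewrite dimvf /dim /= muln1. Qed.

Lemma nbc_Im_basis : basis_of {:ext K n} (nbc ++ Im_basis M L K).
Proof.
rewrite basisEdim; apply/andP; split.
  apply/subvP=> x _; rewrite (ext_expand x); apply: memv_suml => X _.
  by rewrite memvZ // nbc_Im_span.
rewrite dim_ext !size_cat !size_image.
have -> : #|[set D | D \notin indep M]| = #|~: indep M|.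
  by apply: eq_card => D; rewrite !inE.
have sN : NBC M L \subset indep M by apply/subsetP => I; apply: NBC_indep.
have := card_inactive; have := cardsID (NBC M L) (indep M); rewrite (setIidPr sN).
by have := cardsC (indep M); rlia.
Qed.

(** By the antiderivation rule, a generator times the boundary of [e U] is, up to sign, a boundary
    over a larger set plus the dependent monomial [e U]. [ext_d_mem] covers that larger set even if
    it is not inactive. *)
Lemma Im_basis_ideall (x y : ext K n) : y \in S -> x * y \in S.
Proof.
apply: ext_ideal_mull => i v; apply: span_mull => g.
have depi D : D \notin indep M -> e [set i] * e D \in S.
  move=> dD; have [iD|iD] := boolP (i \in D); first by rewrite ext_mul_in ?mem0v.
  rewrite ext_mul_notin // memvZ // dep_mem //; apply: contra dD => /indepS; apply.
  exact: subsetUr.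
rewrite mem_cat => /orP[] /imageP[U]; rewrite inE; last by move=> dD ->; apply: depi.
case/andP=> /unidependentP[C [CL C1 CU _]] _ ->.
have cC := linear_class_circuit CL.
have -> : e [set i] * ext_d (e U) = - (ext_d (e [set i] * e U) + e U).
  by rewrite ext_d_mul opprD opprK addrAC subrr add0r.
rewrite memvN memvD ?dep_mem ?(circuit_dep cC) //.
have [iU|iU] := boolP (i \in U); first by rewrite ext_mul_in ?linear0 ?mem0v.
rewrite ext_mul_notin // linearZ memvZ // (ext_d_mem CL C1) //.
exact: subset_trans CU (subsetUr _ _).
Qed.

Lemma Im_basis_idealr (x y : ext K n) : x \in S -> x * y \in S.
Proof.
apply: ext_ideal_mulr => i v; apply: span_mulr => g gS.
have h : e [set i] * g \in S by apply/Im_basis_ideall/memv_span.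
move: gS; rewrite mem_cat => /orP[] /imageP[U _ eg]; move: h; rewrite eg => h.
  by rewrite ext_d_mulC memvZ.
by rewrite ext_mulC memvZ.
Qed.

Lemma Im_idealE : ideal_gen (Im_gens M L K) = S.
Proof.
apply/eqP; rewrite eqEsubv; apply/andP; split.
  apply: ideal_gen_min; [exact: Im_basis_ideall|exact: Im_basis_idealr|].
  move=> g; rewrite mem_cat => /orP[] /imageP[C].
    by rewrite inE => /andP[CL C1] ->; apply: ext_d_mem CL C1 (subxx _).
  by move=> cC ->; apply/dep_mem/(circuit_dep cC).
have gC C : C \in circuits M -> e C \in ideal_gen (Im_gens M L K).
  move=> cC; apply: mem_ideal_gen; rewrite mem_cat; apply/orP; right.
  exact: image_f.
have Vm := @ideal_gen_mull _ _ (Im_gens M L K).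
apply/span_subvP => g; rewrite mem_cat => /orP[] /imageP[U]; rewrite inE.
  move=> /andP[/unidependentP[C [CL C1 CU _]] _ ->].
  rewrite -(setUidPl CU); apply: ideal_ext_d => //; first exact/gC/linear_class_circuit/CL.
  apply: mem_ideal_gen; rewrite mem_cat; apply/orP; left; apply: image_f.
  by rewrite inE CL.
move/dep_circuit=> [C cC CU] ->; rewrite -(setUidPl CU).
by apply: ideal_ext_e => //; apply: gC.
Qed.

Lemma Im_basis_of : basis_of (ideal_gen (Im_gens M L K)) (Im_basis M L K).
Proof.
rewrite Im_idealE /basis_of eqxx /=.
have /basis_free := nbc_Im_basis; by rewrite cat_free => /and3P[].
Qed.

End BiasIdeal.

(** * The bias algebra as a quotient of the exterior algebra *)

Section ExteriorWiden.
Variables (K : fieldType) (n : nat).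
Implicit Types (A : {set 'I_n}) (X : {set 'I_n.+1}) (y : ext K n) (v : ext K n.+1).
Local Notation w := (widen_ord (leqnSn n)).

Lemma below_widen i A : below (w i) (widen_set A) = below i A.
Proof. by rewrite /below big_imset //= => x y _ _ /widen_inj. Qed.

Definition ext_widen y : ext K n.+1 := \sum_A y A *: ext_e K (widen_set A).

Fact ext_widen_linear : linear ext_widen.
Proof.
move=> k x y; rewrite /ext_widen scaler_sumr -big_split; apply: eq_bigr => X _ /=.
by rewrite !ffunE scalerDl scalerA.
Qed.

HB.instance Definition _ :=
  GRing.isLinear.Build K (ext K n) (ext K n.+1) _ ext_widen ext_widen_linear.

(* the algebra morphism that kills the last generator *)
Definition ext_narrow v : ext K n := [ffun A => v (widen_set A)].

Fact ext_narrow_linear : linear ext_narrow.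
Proof. by move=> k x y; apply/ffunP=> A; rewrite !ffunE. Qed.

HB.instance Definition _ :=
  GRing.isLinear.Build K (ext K n.+1) (ext K n) _ ext_narrow ext_narrow_linear.

Lemma ext_widen_e A : ext_widen (ext_e K A) = ext_e K (widen_set A).
Proof.
rewrite /ext_widen (bigD1 A) //= big1 => [|B neq]; rewrite ffunE.
  by rewrite eqxx scale1r addr0.
by rewrite (negPf neq) scale0r.
Qed.

Lemma ext_narrow_e A : ext_narrow (ext_e K (widen_set A)) = ext_e K A.
Proof. by apply/ffunP=> B; rewrite !ffunE (inj_eq (@widen_set_inj n)). Qed.

Lemma ext_narrow_max X : ord_max \in X -> ext_narrow (ext_e K X) = 0.
Proof.
move=> mX; apply/ffunP=> B; rewrite !ffunE; case: eqP => // eB.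
by rewrite -eB max_widen in mX.
Qed.

Lemma ext_widenK y : ext_narrow (ext_widen y) = y.
Proof.
rewrite /ext_widen linear_sum [RHS]ext_expand; apply: eq_bigr => A _.
by rewrite linearZ /= ext_narrow_e.
Qed.

Lemma ext_d_widen A : ext_d (ext_e K (widen_set A)) = ext_widen (ext_d (ext_e K A)).
Proof.
rewrite !ext_dE linearN; congr (- _); rewrite linear_sum.
rewrite big_imset /= => [|i j _ _ /widen_inj //]; apply: eq_bigr => i _.
by rewrite linearZ /= ext_widen_e below_widen widen_setD1.
Qed.

Lemma ext_narrow_mul_max v : ext_narrow (ext_e K [set ord_max] * v) = 0.
Proof.
rewrite (ext_expand v) mulr_sumr linear_sum big1 // => X _.
rewrite -scalerAr linearZ /= ext_mulE linearZ /= ext_narrow_max ?scaler0 //.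
by rewrite in_setU set11.
Qed.

Lemma ext_narrow_mulr_max v : ext_narrow (v * ext_e K [set ord_max]) = 0.
Proof.
rewrite (ext_expand v) mulr_suml linear_sum big1 // => X _.
rewrite -scalerAl linearZ /= ext_mulE linearZ /= ext_narrow_max ?scaler0 //.
by rewrite in_setU set11 orbT.
Qed.

Lemma ext_narrow_mul i v :
  ext_narrow (ext_e K [set w i] * v) = ext_e K [set i] * ext_narrow v.
Proof.
rewrite (ext_expand v) mulr_sumr !linear_sum mulr_sumr; apply: eq_bigr => X _.
rewrite -scalerAr !linearZ /= -scalerAr; congr (_ *: _).
have [[A ->]|[A ->]] := widen_setP X; last first.
  rewrite ext_mulE linearZ /= !ext_narrow_max ?setU11 ?scaler0 ?mulr0 //.
  by rewrite in_setU setU11 orbT.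
rewrite ext_narrow_e; have [iA|iA] := boolP (i \in A).
  by rewrite !ext_mul_in ?mem_widen // linear0.
by rewrite !ext_mul_notin ?mem_widen // linearZ /= -widen_setU1 ext_narrow_e below_widen.
Qed.

Lemma ext_narrow_mulr i v :
  ext_narrow (v * ext_e K [set w i]) = ext_narrow v * ext_e K [set i].
Proof.
rewrite (ext_expand v) mulr_suml !linear_sum mulr_suml; apply: eq_bigr => X _.
rewrite -scalerAl !linearZ /= -scalerAl; congr (_ *: _).
rewrite ext_mulC linearZ /= ext_narrow_mul.
have [[A ->]|[A ->]] := widen_setP X; last first.
  by rewrite ext_narrow_max ?setU11 // mulr0 mul0r scaler0.
by rewrite ext_narrow_e ext_mulC card_widen.
Qed.

(** Only the term deleting [ord_max] survives. *)
Lemma ext_narrow_d_max A :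
  ext_narrow (ext_d (ext_e K (ord_max |: widen_set A))) =
  (-1) ^+ (below ord_max (widen_set A)).+1 *: ext_e K A.
Proof.
rewrite ext_eU1 ?max_widen // linearZ /= ext_d_mul linearZ linearN linearD /=.
by rewrite ext_narrow_mul_max addr0 ext_narrow_e scalerN exprS mulN1r scaleNr.
Qed.

End ExteriorWiden.

(** * The kernel of the map from the exterior algebra to the bias algebra *)

Section BiasKernel.
Variables (K : fieldType) (n : nat) (M : matroid 'I_n) (L : linear_class M).
Implicit Types (A C D U : {set 'I_n}) (X : {set 'I_n.+1}).
Local Notation N := (extended_lift L).
Local Notation Z := (bias_algebra K L).
Local Notation I := (ideal_gen (Im_gens M L K)).
Local Notation w := (widen_ord (leqnSn n)).

Local Notation PI := (linfun (@ext_narrow K n) @^-1: I)%VS.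

Lemma narrow_mull (x y : ext K n.+1) : y \in PI -> x * y \in PI.
Proof.
apply: ext_ideal_mull => i v; rewrite !mem_lpreim /= => vI.
have [->|[j ->]] := ordSP i; first by rewrite ext_narrow_mul_max mem0v.
by rewrite ext_narrow_mul ideal_gen_mull.
Qed.

Lemma narrow_mulr (x y : ext K n.+1) : x \in PI -> x * y \in PI.
Proof.
apply: ext_ideal_mulr => i v; rewrite !mem_lpreim /= => vI.
have [->|[j ->]] := ordSP i; first by rewrite ext_narrow_mulr_max mem0v.
by rewrite ext_narrow_mulr ideal_gen_mulr.
Qed.

Lemma dep_I D : D \notin indep M -> ext_e K D \in I.
Proof. by rewrite Im_idealE; apply: dep_mem. Qed.

(** Read off from the rank of [C], which is one less than its size: an unbalanced trace has nullity
    two in [M], and the trace of a circuit through [ord_max] has nullity one. *)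
Lemma lift_circuit (C : {set 'I_n.+1}) : C \in circuits N -> exists A,
  (C = widen_set A /\ A \in lc_set L) \/
  (C = widen_set A /\ ((mrank M A).+1 < #|A|)%N) \/
  (C = ord_max |: widen_set A /\ A \notin indep M).
Proof.
move=> cC; have r := circuit_rank cC; have [[A eA]|[A eA]] := widen_setP C; exists A.
  have [/balancedP bA|bA] := boolP (balanced L A); last first.
    right; left; split=> //; move: r; rewrite eA card_widen lift_rank bA; lia.
  left; split=> //; suff : A \in circuits M by move/bA; apply.
  have dA : A \notin indep M.
    move: r; rewrite eA lift_rank card_widen indep_rank; lia.
  apply/circuitP; split=> // J JA; have /properP[sJ [i iA iJ]] := JA.
  have : widen_set J \in indep N.
    case/circuitP: cC => _; apply; rewrite eA; apply/properP; split; first exact: widen_setS.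
    by exists (w i); rewrite mem_widen.
  rewrite !indep_rank lift_rank card_widen => /eqP <-.
  suff -> : balanced L J by rewrite addn0.
  by apply/balancedP=> D cD DJ; apply: bA cD (subset_trans DJ sJ).
right; right; split=> //; move: r; rewrite eA lift_rank_max cardsU1 max_widen card_widen.
by rewrite indep_rank; lia.
Qed.

Lemma OS_gens_narrow : {subset OS_gens K N <= PI}.
Proof.
move=> g; rewrite mem_cat => /orP[] /imageP[C].
  rewrite inE => /andP[/lift_circuit[A [[-> AL]|[[-> hA]|[-> dA]]]] C1] ->; rewrite mem_lpreim /=.
  - rewrite ext_d_widen ext_widenK; apply: mem_ideal_gen; rewrite mem_cat; apply/orP; left.
    by apply: image_f; rewrite inE AL -card_widen.
  - by rewrite ext_d_widen ext_widenK Im_idealE nullity2_d_mem.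
  by rewrite ext_narrow_d_max memvZ // dep_I.
move=> /lift_circuit[A [[-> AL]|[[-> hA]|[-> dA]]]] ->; rewrite mem_lpreim /=.
- by rewrite ext_narrow_e dep_I // (circuit_dep (linear_class_circuit AL)).
- by rewrite ext_narrow_e dep_I // indep_rank neq_ltn (ltnW hA).
by rewrite ext_narrow_max ?setU11 ?mem0v.
Qed.

Definition lift_pi (v : ext K n.+1) : Z :=
  quotient_pi (bias_ideal K L) (quotient_pi (OS_ideal K N) v).

Fact lift_pi_linear : linear lift_pi.
Proof. by move=> k x y; rewrite /lift_pi !linearP. Qed.

HB.instance Definition _ :=
  GRing.isLinear.Build K (ext K n.+1) Z _ lift_pi lift_pi_linear.

Lemma lift_piM u v : lift_pi (u * v) = lift_pi u * lift_pi v.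
Proof. by rewrite /lift_pi !rmorphM. Qed.

Lemma lift_pi_OS v : v \in ideal_gen (OS_gens K N) -> lift_pi v = 0.
Proof.
move=> vI; rewrite /lift_pi.
have /eqP-> : quotient_pi (OS_ideal K N) v == 0 by rewrite quotient_pi_eq0.
exact: linear0.
Qed.

Lemma lift_pi_max : lift_pi (ext_e K [set ord_max]) = 0.
Proof.
apply/eqP; rewrite /lift_pi quotient_pi_eq0; apply: mem_ideal_gen.
by rewrite mem_seq1.
Qed.

Lemma lift_pi_kernel v : lift_pi v = 0 -> v \in PI.
Proof.
move/eqP; rewrite /lift_pi quotient_pi_eq0.
set p := quotient_pi (OS_ideal K N).
have OSV : {subset ideal_gen (OS_gens K N) <= PI}.
  apply/subvP; apply: ideal_gen_min; [exact: narrow_mull|exact: narrow_mulr|].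
  exact: OS_gens_narrow.
have pP q : reflect (exists2 u, u \in PI & p u = q) (q \in linfun p @: PI)%VS.
  apply: (iffP memv_imgP) => -[u uV]; first by rewrite lfunE => ->; exists u.
  by move=> <-; exists u; rewrite // lfunE.
(* The image of [PI] under the surjection [p] is an ideal containing the class of [ord_max]. So [v]
   agrees with an element of [PI] modulo the Orlik-Solomon ideal, itself inside [PI]. *)
have /subvP h : (ideal_gen (bias_gens K L) <= linfun p @: PI)%VS.
  apply: ideal_gen_min => [x y /pP[u uV <-]|x y /pP[u uV <-]|g].
  - have [t <-] := quotient_pi_surj x; apply/pP; exists (t * u); last exact: rmorphM.
    exact: narrow_mull.
  - have [t <-] := quotient_pi_surj y; apply/pP; exists (u * t); last exact: rmorphM.
    exact: narrow_mulr.
  rewrite mem_seq1 => /eqP->; apply/pP; exists (ext_e K [set ord_max]) => //.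
  by rewrite mem_lpreim /= ext_narrow_max ?set11 ?mem0v.
move=> /h/pP[u uV /eqP]; rewrite -subr_eq0 -linearB quotient_pi_eq0 => /OSV huv.
by rewrite -(subKr u v) memvB.
Qed.

Local Notation Ker := (lker (linfun lift_pi)).

Lemma mem_Ker v : (v \in Ker) = (lift_pi v == 0).
Proof. by rewrite memv_ker lfunE. Qed.

Lemma Ker_mull (x y : ext K n.+1) : y \in Ker -> x * y \in Ker.
Proof. by rewrite !mem_Ker lift_piM => /eqP->; rewrite mulr0. Qed.

Lemma Ker_max X : ord_max \in X -> ext_e K X \in Ker.
Proof.
move=> mX; rewrite -(setD1K mX) setUC; apply: ideal_ext_e; first exact: Ker_mull.
by rewrite mem_Ker lift_pi_max.
Qed.

Lemma Ker_circuit (C : {set 'I_n.+1}) : C \in circuits N -> ext_e K C \in Ker.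
Proof.
move=> cC; rewrite mem_Ker lift_pi_OS // mem_ideal_gen // mem_cat; apply/orP; right.
exact: image_f.
Qed.

Lemma Ker_d_circuit (C : {set 'I_n.+1}) : C \in circuits N -> (1 < #|C|)%N ->
  ext_d (ext_e K C) \in Ker.
Proof.
move=> cC C1; rewrite mem_Ker lift_pi_OS // mem_ideal_gen // mem_cat; apply/orP; left.
by apply: image_f; rewrite inE cC.
Qed.

(** Adding [ord_max] to [D] gives a dependent set of the lift. If the circuit found there passes
    through [ord_max], its boundary yields the monomial of its trace, as all other terms contain
    [ord_max]. *)
Lemma Ker_dep D : D \notin indep M -> ext_e K (widen_set D) \in Ker.
Proof.
move=> dD; have [C cC CD] : exists2 C, C \in circuits N & C \subset ord_max |: widen_set D.
  apply: dep_circuit; rewrite indep_rank lift_rank_max cardsU1 max_widen card_widen.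
  by have := dep_rank dD; rewrite neq_ltn add1n ltnS => ->.
have [[A eA]|[A eA]] := widen_setP C.
  have AD : widen_set A \subset widen_set D.
    apply/subsetP=> x; rewrite -eA => xC; have := subsetP CD x xC.
    rewrite in_setU1 => /predU1P[ex|//].
    by rewrite ex eA max_widen in xC.
  by rewrite -(setUidPl AD); apply: ideal_ext_e; [exact: Ker_mull | rewrite -eA Ker_circuit].
have AD : widen_set A \subset widen_set D.
  apply/subsetP=> x xA; have : x \in C by rewrite eA in_setU1 xA orbT.
  move/(subsetP CD); rewrite in_setU1 => /predU1P[ex|//].
  by rewrite ex max_widen in xA.
rewrite -(setUidPl AD); apply: ideal_ext_e; first exact: Ker_mull.
have mA : ord_max \notin widen_set A by rewrite max_widen.
apply: (ext_e_exchange mA) => [|j jA]; last first.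
  by apply: Ker_max; rewrite in_setD1 setU11 andbT; apply: contraNneq mA => ->.
(* The circuit has more than one element because [ord_max] is not a loop of the lift. *)
rewrite -eA; apply: Ker_d_circuit => //.
rewrite eA cardsU1 mA card_widen add1n ltnS card_gt0; apply: contraTneq cC => eA0.
rewrite eA eA0; apply/negP => /circuitP[]; rewrite indep_rank lift_rank_max.
by rewrite /widen_set imset0 setU0 cards1 eqSS -leqn0 -(cards0 'I_n) mrank_le_card.
Qed.

(** The only circuit in [C] is [C] itself and its proper subsets contain none, so all are balanced
    and keep their rank. *)
Lemma widen_circuit C : C \in lc_set L -> widen_set C \in circuits N.
Proof.
move=> CL; have cC := linear_class_circuit CL; apply/circuitP; split.
  rewrite indep_rank lift_rank card_widen -(circuit_rank cC).
  suff -> : balanced L C by rewrite addn0 neq_ltn leqnn.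
  apply/balancedP=> D cD DC; suff -> : D = C by [].
  apply/eqP; rewrite eqEproper DC /=; apply/negP => DpC.
  by case/circuitP: cC => _ /(_ _ DpC); apply/negP; case/circuitP: cD.
move=> X /properP[XC [x xC xX]].
have [|A eA] := @widen_set_sub _ X.
  by apply/negP=> /(subsetP XC); rewrite max_widen.
have [i iC ex] := imsetP xC.
have AC : A \in indep M.
  case/circuitP: cC => _; apply; apply/properP; split.
    by apply/subsetP=> j jA; rewrite -mem_widen (subsetP XC) // eA mem_widen.
  by exists i => //; rewrite -mem_widen -eA -ex.
rewrite eA indep_rank card_widen lift_rank; move: (AC); rewrite indep_rank => /eqP->.
suff -> : balanced L A by rewrite addn0.
by apply/balancedP=> D cD DA; case/negP: (circuit_dep cD DA).
Qed.

Definition bias_pi (y : ext K n) : Z := lift_pi (ext_widen y).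

Fact bias_pi_linear : linear bias_pi.
Proof. by move=> k x y; rewrite /bias_pi !linearP. Qed.

HB.instance Definition _ :=
  GRing.isLinear.Build K (ext K n) Z _ bias_pi bias_pi_linear.

Lemma bias_pi_e A : bias_pi (ext_e K A) = bias_e K L A.
Proof. by rewrite /bias_pi ext_widen_e. Qed.

Lemma bias_pi_kernel : lker (linfun bias_pi) = I.
Proof.
apply/eqP; rewrite eqEsubv; apply/andP; split; apply/subvP=> y.
  rewrite memv_ker lfunE => /eqP/lift_pi_kernel.
  by rewrite mem_lpreim /= ext_widenK.
rewrite Im_idealE; move: y; apply/subvP/span_subvP => g.
rewrite memv_ker lfunE /= /bias_pi -mem_Ker mem_cat => /orP[] /imageP[U]; rewrite inE; last first.
  by move=> dU ->; rewrite ext_widen_e Ker_dep.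
case/andP=> /unidependentP[C [CL C1 CU _]] _ ->; rewrite -ext_d_widen.
have WC := widen_circuit CL.
rewrite -(setUidPl (widen_setS CU)); apply: ideal_ext_d; first exact: Ker_mull.
  exact: Ker_circuit.
by rewrite Ker_d_circuit // card_widen.
Qed.

Lemma bias_pi_surj : limg (linfun bias_pi) = {:Z}%VS.
Proof.
apply/eqP; rewrite eqEsubv subvf; apply/subvP=> z _.
have [q <-] := quotient_pi_surj z; have [v <-] := quotient_pi_surj q.
rewrite -/(lift_pi v) (ext_expand v) linear_sum; apply: memv_suml => X _.
rewrite linearZ memvZ //=; have [[A ->]|[A ->]] := widen_setP X.
  by rewrite -ext_widen_e -/(bias_pi _) -(lfunE bias_pi) memv_img ?memvf.
have /eqP-> : lift_pi (ext_e K (ord_max |: widen_set A)) == 0.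
  by rewrite -mem_Ker Ker_max ?setU11.
exact: mem0v.
Qed.

(** The joint basis maps onto a spanning family in which the ideal part vanishes; rank-nullity shows
    that the remaining monomials are no more than the dimension. *)
Lemma nbc_bias_basis : basis_of {:Z} [seq bias_e K L J | J : {set 'I_n} in NBC M L].
Proof.
have nbcI := nbc_Im_basis K L; have Ib := Im_basis_of K L.
have eZ : [seq bias_e K L J | J : {set 'I_n} in NBC M L] =
    map (linfun bias_pi) [seq ext_e K J | J : {set 'I_n} in NBC M L].
  by rewrite -map_comp; apply: eq_map => J /=; rewrite lfunE /= bias_pi_e.
rewrite eZ basisEdim size_map; apply/andP; split.
  rewrite -bias_pi_surj -(span_basis nbcI) limg_span map_cat (span_cat (map _ _)).
  rewrite subv_add subvv; apply/span_subvP => _ /mapP[g gI ->].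
  have : g \in lker (linfun bias_pi).
    by rewrite bias_pi_kernel; apply: (basis_mem Ib).
  by rewrite memv_ker => /eqP->; rewrite mem0v.
have := limg_ker_dim (linfun bias_pi) fullv; rewrite bias_pi_surj capfv bias_pi_kernel.
have dimE (A : vectType K) (U : {vspace A}) s : basis_of U s -> \dim U = size s.
  by case/andP=> /eqP <- /eqP.
by rewrite (dimE _ _ _ Ib) (dimE _ _ _ nbcI) (size_cat [seq _ | _ in NBC M L]) => eZdim;
   rewrite -(leq_add2l (size (Im_basis M L K))) eZdim addnC.
Qed.

End BiasKernel.

Theorem theorem3p9 (n : nat) (K : fieldType) (M : matroid 'I_n)
    (L : linear_class M) :
  basis_of {: bias_algebra K L}
    [seq bias_e K L J | J : {set 'I_n} in NBC M L] /\
  basis_of (ideal_gen (Im_gens M L K)) (Im_basis M L K).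
Proof. by split; [apply: nbc_bias_basis | apply: Im_basis_of]. Qed.
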